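(* Let $(\mathcal X,\rho)$ be a Polish space, $\mu\in P_2(\mathcal X)$ and $a>0$. The following are equivalent: (1) There exist $r_o,b\ge0$ such that for all $n\ge1$, all measurable $A\subset\mathcal X^n$ with $\mu^n(A)\ge1/2$ and all $r\ge r_o$, $\mu^n(A^r)\ge 1-b\,e^{-a(r-r_o)^2}$. (2) $\mu$ satisfies $\mathbf T_2(1/a)$: $\mathcal T_2(\nu,\mu)\le\frac1a H(\nu\,|\,\mu)$ for all Borel probability measures $\nu$ on $\mathcal X$.
   Context: $P_2(\mathcal X)$: probability measures with finite second moment $\int\rho(x_o,x)^2d\nu<\infty$. $\mathcal T_2(\nu,\mu)=\inf_\pi\int\rho(x,y)^2d\pi(x,y)$ over couplings $\pi$ of $\nu,\mu$. $H(\nu\,|\,\mu)=\int\log\frac{d\nu}{d\mu}d\nu$ if $\nu\ll\mu$, $+\infty$ otherwise. On $\mathcal X^n$ use the metric $\rho_2^n(x,y)=\big(\sum_{i=1}^n\rho(x^i,y^i)^2\big)^{1/2}$ for $x=(x^1,\dots,x^n)$, and $A^r=\{x\in\mathcal X^n:\exists\bar x\in A,\ \rho_2^n(x,\bar x)\le r\}$. *)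

(* Defs.v *)
From HB Require Import structures.
From mathcomp Require Import all_boot all_order all_algebra.
From mathcomp Require Import all_classical all_reals all_analysis.
Set Implicit Arguments. Unset Strict Implicit. Unset Printing Implicit Defensive.
Import Order.TTheory GRing.Theory Num.Theory.
Import numFieldNormedType.Exports.
Local Open Scope classical_set_scope.
Local Open Scope ring_scope.

Section defs.
Context {R : realType}.

Definition is_metric {X : Type} (rho : X -> X -> R) : Prop :=
  [/\ forall x y, 0 <= rho x y,
      forall x y, rho x y = 0 <-> x = y,
      forall x y, rho x y = rho y x &
      forall x y z, rho x z <= rho x y + rho y z].

Definition rho_open {X : Type} (rho : X -> X -> R) (U : set X) : Prop :=
  forall x, U x -> exists2 e : R, 0 < e & forall y, rho x y < e -> U y.

Definition rho_complete {X : Type} (rho : X -> X -> R) : Prop :=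
  forall u : nat -> X,
    (forall e : R, 0 < e -> exists N, forall m n, (N <= m)%N -> (N <= n)%N ->
        rho (u m) (u n) < e) ->
    exists l, forall e : R, 0 < e -> exists N, forall n, (N <= n)%N -> rho (u n) l < e.

Definition rho_separable {X : Type} (rho : X -> X -> R) : Prop :=
  exists D : nat -> X, forall x (e : R), 0 < e -> exists k, rho x (D k) < e.

Definition polish_borel {d} (X : measurableType d) (rho : X -> X -> R) : Prop :=
  [/\ is_metric rho, rho_complete rho, rho_separable rho &
      (@measurable d X) = <<s rho_open rho >>].

Definition finite_second_moment {d} {X : measurableType d} (rho : X -> X -> R)
    (mu : probability X R) : Prop :=
  exists xo : X, (\int[mu]_x ((rho xo x) ^+ 2)%:E < +oo)%E.

Definition rho2n {X : Type} (rho : X -> X -> R) (n : nat) (x y : n.-tuple X) : R :=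
  Num.sqrt (\sum_(i < n) (rho (tnth x i) (tnth y i)) ^+ 2).

Definition enlarge {X : Type} (rho : X -> X -> R) (n : nat)
    (A : set (n.-tuple X)) (r : R) : set (n.-tuple X) :=
  [set x | exists2 xb, A xb & rho2n rho x xb <= r].

(* outer measure (equal to the completed measure on universally measurable sets) *)
Definition outer {d} {T : measurableType d} (P : set T -> \bar R) (S : set T) : \bar R :=
  ereal_inf [set P B | B in [set B | measurable B /\ S `<=` B]].

Definition is_prod_measure {d} {X : measurableType d} (n : nat) (mu : probability X R)
    (P : {measure set (n.-tuple X) -> \bar R}) : Prop :=
  forall A : 'I_n -> set X, (forall i, measurable (A i)) ->
    P [set x | forall i, A i (tnth x i)] = (\prod_(i < n) mu (A i))%E.

Definition coupling {d} {X : measurableType d} (nu mu : probability X R)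
    (pi : probability (X * X)%type R) : Prop :=
  (forall A, measurable A -> pi (A `*` setT) = nu A) /\
  (forall B, measurable B -> pi (setT `*` B) = mu B).

Definition transport_cost2 {d} {X : measurableType d} (rho : X -> X -> R)
    (nu mu : probability X R) : \bar R :=
  ereal_inf [set (\int[pi]_z ((rho z.1 z.2) ^+ 2)%:E)%E
            | pi in [set pi | coupling nu mu pi]].

Definition rel_entropy {d} {X : measurableType d} (nu mu : probability X R) : \bar R :=
  match pselect (nu `<< mu) with
  | left _ => (\int[nu]_x
       (ln (fine (Radon_Nikodym (charge_of_finite_measure nu) mu x)))%:E)%E
  | right _ => +oo%E
  end.

End defs.

(* Main.v *)
Require Import Defs.
From HB Require Import structures.
From mathcomp Require Import all_boot all_order all_algebra.
From mathcomp Require Import all_classical all_reals all_analysis.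
From mathcomp Require Import measurable_realfun ring lra.
Import Order.TTheory GRing.Theory Num.Theory.
Import numFieldNormedType.Exports.
Set Implicit Arguments. Unset Strict Implicit. Unset Printing Implicit Defensive.
Local Open Scope classical_set_scope.
Local Open Scope ring_scope.

(** From [T_2] to concentration.  Testing [T_2] on Gibbs measures gives the dual
    (infimum convolution) inequality: if [f x - g y <= rho x y ^ 2] for all
    [x], [y], then [\int e^(a f) d mu <= e^(a \int g d mu)].  This inequality
    tensorizes by minimizing over one block of coordinates at a time.  With
    [D = rho_2^n(., A)^2] truncated at [r^2], a first application bounds
    [a \int D d mu^n] by [ln (1 / mu^n A) <= ln 2]; a second one, applied to
    multiples of [D] by means of
    [(1 - s) D x <= (1 - s) / s * D y + rho_2^n(x, y)^2] and Markov's
    inequality, yields the sharp Gaussian rate with [r_o = sqrt (ln 2 / a)],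
    [b = 1], after taking [s = r_o / r].

    From concentration to [T_2].  Let [nu = f mu] with entropy [H < a c].  By the
    weak law of large numbers, the [n]-samples [x] with typical empirical averages
    under [nu] and with [\sum ln f(x_i) < n t], where [H < t < a c], have
    [nu^n]-probability at least 1/2, hence [mu^n]-probability at least
    [e^(- n t) / 2].  If they were all at distance more than [sqrt (n c)] from the
    samples [y] that are typical under [mu], concentration would bound this
    probability by about [e^(- n a c)].  So there are typical samples [x], [y] with
    [\sum rho(x_i, y_i)^2 <= n c], and pairing the cells of [x_i] and [y_i] in a
    fine partition produces a coupling of [nu] and [mu] of cost close to [c]. *)

(** * Densities and product measures *)

(** The constant [a] survives both directions without loss. In the converse, concentration is used
    at radius sqrt (n c) with n large: there [r_o] changes the exponent n a c only by O(sqrt n) and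
    [b] only multiplies by a constant, and the strict gap between the entropy and a c absorbs both.
    Measurability shapes the passage to concentration: infimum convolutions and enlargements need
    not be Borel. One of the two test functions is therefore kept Lipschitz, so that infima reduce
    to a countable dense set, and the enlargement is bounded below by a measurable sublevel set of
    the truncated distance. The converse uses neither optimal couplings nor compactness: the
    coupling has an explicit density with respect to nu x mu, a finite sum of products. Sample
    frequencies match cell probabilities only up to an error, so a residual of small mass is coupled
    independently. Its cost is controlled by second moments, and that of nu must itself be extracted
    from concentration, by a preliminary use of the same pairs of samples. *)

Lemma density_probability d (T : measurableType d) (R : realType)
    (m : probability T R) (g : T -> R) :
  (forall x, 0 <= g x) -> measurable_fun setT g ->
  (\int[m]_x (g x)%:E = 1)%E ->
  exists nu : probability T R,
    (forall A, measurable A -> nu A = \int[m]_(x in A) (g x)%:E)%E /\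
    (forall phi : T -> \bar R, (forall x, 0 <= phi x)%E ->
      measurable_fun setT phi ->
      \int[nu]_x phi x = \int[m]_x (phi x * (g x)%:E))%E.
Proof.
move=> g0 mg g1; have mgE : measurable_fun setT (EFin \o g).
  exact/measurable_EFinP.
pose dens (A : set T) := (\int[m]_(x in A) (g x)%:E)%E.
have d0 : dens set0 = 0%E by rewrite /dens integral_set0.
have dge0 A : (0 <= dens A)%E by apply: integral_ge0 => x _; rewrite lee_fin.
have dsig : semi_sigma_additive dens.
  move=> /= A mA tA mUA.
  rewrite /dens/= ge0_integral_bigcup//=; last 2 first.
  - exact: measurable_funTS.
  - by move=> x _; rewrite lee_fin.
  apply: is_cvg_ereal_nneg_natsum_cond => n _ _.
  by apply: integral_ge0 => /= x _; rewrite lee_fin.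
pose ms := isMeasure.Build _ _ _ dens d0 dge0 dsig.
pose mm : {measure set T -> \bar R} := HB.pack dens ms.
pose ps := Measure_isProbability.Build _ _ _ mm g1.
pose nu : probability T R := HB.pack dens ms ps.
exists nu; split => // phi phi0 mphi.
have ig : m.-integrable setT (EFin \o g).
  apply/integrableP; split => //.
  under eq_integral do rewrite gee0_abs ?lee_fin//.
  by rewrite g1 ltry.
have num : nu `<< m.
  apply/null_content_dominatesP => A mA mA0 /=.
  rewrite /dens; apply: null_set_integral => //.
  exact: measurable_funTS.
(* The Radon-Nikodym derivative of [nu] equals [g] almost everywhere, since both have the same
   integral over every measurable set. *)
rewrite -(Radon_Nikodym_SigmaFinite.change_of_variables num)//.
apply: ae_eq_integral => //.
- apply: emeasurable_funM => //.
  exact: (measurable_int _ (Radon_Nikodym_SigmaFinite.f_integrable num)).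
- exact: emeasurable_funM.
- apply: ae_eqe_mul2l; apply: integral_ae_eq => //.
    exact: Radon_Nikodym_SigmaFinite.f_integrable.
  by move=> E _ mE; rewrite -Radon_Nikodym_SigmaFinite.f_integral.
Qed.

Section product_power.
Context {R : realType} {d} {X : measurableType d}.
Local Open Scope ereal_scope.
Implicit Type mu : probability X R.

Definition consp n (z : X * n.-tuple X) : n.+1.-tuple X := [tuple of z.1 :: z.2].

Lemma measurable_consp n : measurable_fun setT (@consp n).
Proof. exact: measurable_cons. Qed.

Lemma pushforward_probability d1 d2 (T1 : measurableType d1)
    (T2 : measurableType d2) (P : probability T1 R) (f : T1 -> T2) :
  measurable_fun setT f ->
  {Q : probability T2 R | forall A, Q A = P (f @^-1` A)}.
Proof.
move=> mf.
pose fm := isMeasurableFun.Build _ _ _ _ f mf.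
pose ff : {mfun T1 >-> T2} := HB.pack f fm.
by exists (distribution P ff).
Qed.

(** An iterated binary product pushed forward along [consp], so that Tonelli and Fubini peel off one
    coordinate at a time. *)
Fixpoint power_measure mu n : probability (n.-tuple X) R :=
  match n with
  | 0 => dirac [tuple]
  | m.+1 => sval (pushforward_probability (mu \x power_measure mu m)
                    (@measurable_consp m))
  end.

Lemma power_measureS mu n A :
  power_measure mu n.+1 A = (mu \x power_measure mu n) (@consp n @^-1` A).
Proof. by rewrite /=; case: pushforward_probability => Q /= ->. Qed.

Lemma measurable_rectangle n (A : 'I_n -> set X) :
  (forall i, measurable (A i)) ->
  measurable [set x : n.-tuple X | forall i, A i (tnth x i)].
Proof.
move=> mA.
have -> : [set x : n.-tuple X | forall i, A i (tnth x i)] =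
    \bigcap_(i in [set: 'I_n]) ((@tnth n X ^~ i) @^-1` A i).
  by apply/seteqP; split=> x h i => [_|]; apply: h.
apply: fin_bigcap_measurable => [|i _]; first exact: finite_finset.
by rewrite -[X in measurable X]setTI; exact: measurable_tnth.
Qed.

Lemma power_measure_prod mu n : is_prod_measure mu (power_measure mu n).
Proof.
rewrite /is_prod_measure; elim: n => [|n IH] A mA.
  by rewrite big_ord0 /= diracE mem_set// => -[].
rewrite [LHS](power_measureS mu) big_ord_recl.
have -> : consp (n:=n) @^-1` [set x | forall i, A i (tnth x i)] =
    A ord0 `*` [set x | forall i, A (lift ord0 i) (tnth x i)].
  apply/seteqP; split => -[x y] /=.
    by move=> h; split => [|i]; [exact: (h ord0)|have := h (lift ord0 i); rewrite tnthS].
  move=> [h0 h1] i; case: (unliftP ord0 i) => [j ->|-> //].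
  by rewrite tnthS.
rewrite product_measure1E//; last first.
  by have := @measurable_rectangle n (fun i => A (lift ord0 i)); exact.
by congr (_ * _); exact: (IH (fun i => A (lift ord0 i))).
Qed.

Definition rectangles n : set (set (n.-tuple X)) :=
  [set [set x | forall i, A i (tnth x i)] |
     A in [set A : 'I_n -> set X | forall i, measurable (A i)]].

Lemma measurable_rectangles n : @measurable _ (n.-tuple X) = <<s @rectangles n >>.
Proof.
apply/seteqP; split.
  apply: smallest_sub; first exact: smallest_sigma_algebra.
  move=> B; rewrite -bigcup_seq => -[i _] [A mA <-].
  apply: sub_sigma_algebra.
  exists (fun j => if j == i then A else setT) => [j|]; first by case: ifP.
  apply/seteqP; split => x /=; first by move=> /(_ i); rewrite eqxx.
  by move=> [_ Ax] j; case: ifP => // /eqP ->.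
apply: smallest_sub; first exact: sigma_algebra_measurable.
move=> _ [A mA <-].
exact: measurable_rectangle.
Qed.

(** Rectangles form a generating class stable under intersection. The theorem speaks of any measure
    with the product property, and this reduces it to [power_measure]. *)
Lemma prod_measure_unique mu n (P : {measure set (n.-tuple X) -> \bar R}) :
  is_prod_measure mu P ->
  forall A, measurable A -> P A = power_measure mu n A.
Proof.
move=> hP A mA.
apply: (measure_unique (@rectangles n) (fun=> setT)) => //.
- exact: measurable_rectangles.
- move=> _ _ [B mB <-] [C mC <-]; exists (fun i => B i `&` C i).
    by move=> i; exact: measurableI.
  apply/seteqP; split=> x /=; first by move=> h; split=> i; have [] := h i.
  by move=> [h1 h2] i; split.
- by move=> _; exists (fun=> setT) => //; apply/seteqP; split.
- by apply/seteqP; split => // x _; exists 0%N.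
- by move=> _ [B mB <-]; rewrite hP// power_measure_prod.
- move=> _; have := hP (fun=> setT) (fun=> measurableT).
  have -> : [set x : n.-tuple X | forall i : 'I_n, [set: X] (tnth x i)] = setT.
    by apply/seteqP; split.
  by move=> ->; rewrite big1 ?ltry// => i _; exact: probability_setT.
Qed.

Lemma ge0_integral_powerS mu n (f : n.+1.-tuple X -> \bar R) :
  measurable_fun setT f -> (forall x, 0 <= f x) ->
  \int[power_measure mu n.+1]_x f x =
  \int[power_measure mu n]_y \int[mu]_x f (consp (x, y)).
Proof.
move=> mf f0.
transitivity (\int[pushforward (mu \x power_measure mu n) (@consp n)]_x f x).
  apply: eq_measure_integral; first exact: measurable_consp.
  by move=> ? A mA _; exact: (power_measureS mu).
rewrite ge0_integral_pushforward//; last exact: measurable_consp.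
rewrite preimage_setT (fubini_tonelli2 (f \o @consp n))//.
  by apply: measurableT_comp => //; exact: measurable_consp.
by move=> z; exact: f0.
Qed.

End product_power.

(** * Separable metric spaces *)

Lemma measurable_fun_lt_set d (T : measurableType d) (R : realType) (f : T -> R) :
  (forall t, measurable [set x | f x < t]) -> measurable_fun setT f.
Proof.
move=> h; apply: (measurability _ (RGenInftyO.measurableE R)) => //.
move=> _ [_ [t ->] <-]; rewrite setTI.
have -> : f @^-1` `]-oo, t[ = [set x | f x < t] by
  apply/seteqP; split=> x /=; rewrite in_itv.
exact: h.
Qed.

Section separable_metric.
Context {R : realType} {d} {X : measurableType d}.
Variable rho : X -> X -> R.
Hypothesis hrho : polish_borel rho.

Definition sqdist n (x y : n.-tuple X) : R :=
  \sum_(i < n) rho (tnth x i) (tnth y i) ^+ 2.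
Definition dist1 n (x y : n.-tuple X) : R :=
  \sum_(i < n) rho (tnth x i) (tnth y i).

(** The l^1 distance splits off the first coordinate additively, so integrating that coordinate out
    keeps the constant [L]. *)
Definition dist1_lipschitz n (G : n.-tuple X -> R) :=
  exists2 L, 0 <= L & forall x y, G x <= G y + L * dist1 x y.

Lemma rho_ge0 x y : 0 <= rho x y. Proof. by case: hrho => -[]. Qed.
Lemma rhoxx x : rho x x = 0.
Proof. by case: hrho => -[_ h _ _ _ _ _]; apply/h. Qed.
Lemma rhoC x y : rho x y = rho y x.
Proof. by case: hrho => -[_ _ h _ _ _ _]; apply: h. Qed.
Lemma rho_triangle x y z : rho x z <= rho x y + rho y z.
Proof. by case: hrho => -[_ _ _ h _ _ _]; apply: h. Qed.

Lemma sqdist_ge0 n (x y : n.-tuple X) : 0 <= sqdist x y.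
Proof. by apply: sumr_ge0 => i _; exact: sqr_ge0. Qed.
Lemma dist1_ge0 n (x y : n.-tuple X) : 0 <= dist1 x y.
Proof. by apply: sumr_ge0 => i _; exact: rho_ge0. Qed.
Lemma sqdistxx n (x : n.-tuple X) : sqdist x x = 0.
Proof. by rewrite /sqdist big1 // => i _; rewrite rhoxx expr0n. Qed.
Lemma sqdistC n (x y : n.-tuple X) : sqdist x y = sqdist y x.
Proof. by apply: eq_bigr => i _; rewrite rhoC. Qed.
Lemma dist1C n (x y : n.-tuple X) : dist1 x y = dist1 y x.
Proof. by apply: eq_bigr => i _; rewrite rhoC. Qed.

Lemma rho_le_dist1 n (x y : n.-tuple X) i : rho (tnth x i) (tnth y i) <= dist1 x y.
Proof.
by rewrite /dist1 (bigD1 i)//= lerDl; apply: sumr_ge0 => j _; exact: rho_ge0.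
Qed.

Lemma rho_sqr_le_sqdist n (x y : n.-tuple X) i :
  rho (tnth x i) (tnth y i) ^+ 2 <= sqdist x y.
Proof.
by rewrite /sqdist (bigD1 i)//= lerDl; apply: sumr_ge0 => j _; exact: sqr_ge0.
Qed.

Lemma sqdist_cons n x (y : n.-tuple X) x' (y' : n.-tuple X) :
  sqdist (consp (x, y)) (consp (x', y')) = rho x x' ^+ 2 + sqdist y y'.
Proof.
by rewrite /sqdist big_ord_recl /=; congr (_ + _); apply: eq_bigr => i _; rewrite !tnthS.
Qed.

Lemma dist1_cons n x (y : n.-tuple X) x' (y' : n.-tuple X) :
  dist1 (consp (x, y)) (consp (x', y')) = rho x x' + dist1 y y'.
Proof.
by rewrite /dist1 big_ord_recl /=; congr (_ + _); apply: eq_bigr => i _; rewrite !tnthS.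
Qed.

Lemma measurable_rho_ball z r : measurable [set x | rho x z < r].
Proof.
case: hrho => _ _ _ ->; apply: sub_sigma_algebra => x /= xr.
exists (r - rho x z) => [|y xy]; first by rewrite subr_gt0.
by have := rho_triangle y x z; rewrite (rhoC y x); lra.
Qed.

Lemma measurable_rhol z : measurable_fun setT (rho ^~ z).
Proof. by apply: measurable_fun_lt_set => t; exact: measurable_rho_ball. Qed.

(** [X * X] carries the product sigma-algebra; separability writes [rho x y < t] as a countable
    union of conditions on distances to fixed points. *)
Lemma measurable_rho : measurable_fun setT (fun z : X * X => rho z.1 z.2).
Proof.
have [D hD] : rho_separable rho by case: hrho.
apply: measurable_fun_lt_set => t.
have -> : [set z : X * X | rho z.1 z.2 < t] =
    \bigcup_k [set z | rho z.1 (D k) + rho z.2 (D k) < t].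
  apply/seteqP; split => -[x y] /=.
    move=> xyt; have e0 : 0 < (t - rho x y) / 2 by rewrite divr_gt0// subr_gt0.
    have [k yk] := hD y _ e0; exists k => //=.
    by have := rho_triangle x y (D k); lra.
  move=> [k _] /=; apply: le_lt_trans.
  by rewrite (rhoC y); exact: rho_triangle.
apply: bigcup_measurable => k _.
rewrite -[X in measurable X]setTI.
apply: (@measurable_fun_ltr _ _ _ setT
  (fun z : X * X => rho z.1 (D k) + rho z.2 (D k)) (cst t)) => //.
apply: measurable_funD.
- exact: (@measurableT_comp _ _ _ _ _ _ (rho ^~ (D k)) _ fst (measurable_rhol _)).
- exact: (@measurableT_comp _ _ _ _ _ _ (rho ^~ (D k)) _ snd (measurable_rhol _)).
Qed.

Lemma measurable_rhol_tnth n (z : X) (i : 'I_n) :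
  measurable_fun setT (fun x : n.-tuple X => rho (tnth x i) z).
Proof.
exact: (@measurableT_comp _ _ _ _ _ _ (rho ^~ z) _ (@tnth n X ^~ i)
  (measurable_rhol _) (measurable_tnth _)).
Qed.

Lemma measurable_sqdistl n (z : n.-tuple X) : measurable_fun setT (@sqdist n ^~ z).
Proof.
apply: (measurable_sum _) => i; apply: measurable_funX; exact: measurable_rhol_tnth.
Qed.

Lemma measurable_dist1l n (z : n.-tuple X) : measurable_fun setT (@dist1 n ^~ z).
Proof. by apply: (measurable_sum _) => i; exact: measurable_rhol_tnth. Qed.

Lemma tuple_separable n : exists D : n.-tuple nat -> n.-tuple X,
  forall x (e : R), 0 < e -> exists k, dist1 x (D k) < e.
Proof.
have [D hD] : rho_separable rho by case: hrho.
exists (map_tuple D) => x e e0.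
have e1 : 0 < e / n.+1%:R by rewrite divr_gt0.
have /choice[k hk] : forall i : 'I_n, exists k, rho (tnth x i) (D k) < e / n.+1%:R.
  by move=> i; exact: hD.
exists [tuple k i | i < n].
apply: (@le_lt_trans _ _ (\sum_(i < n) e / n.+1%:R)).
  by apply: ler_sum => i _; rewrite tnth_map tnth_mktuple ltW.
rewrite sumr_const card_ord -[_ *+ n]mulr_natr -mulrA gtr_pMr// mulrC ltr_pdivrMr//.
by rewrite mul1r ltr_nat.
Qed.

(** A Lipschitz function is the infimum of the cones [G (D k) + L * dist1 x (D k)] over a countable
    dense sequence. *)
Lemma measurable_dist1_lipschitz n (G : n.-tuple X -> R) :
  dist1_lipschitz G -> measurable_fun setT G.
Proof.
move=> [L L0 GL]; have [D hD] := tuple_separable n.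
apply: measurable_fun_lt_set => t.
have -> : [set x | G x < t] = \bigcup_k [set x | G (D k) + L * dist1 x (D k) < t].
  apply/seteqP; split => x /=.
    (* The distance to [D k] is paid twice, in [G (D k)] and in the cone, so [2 * L * dist1 x (D k)]
       must stay below [t - G x]. *)
    move=> xt; have e0 : 0 < (t - G x) / (2 * (L + 1)).
      by rewrite divr_gt0 ?subr_gt0//; lra.
    have [k xk] := hD x _ e0; exists k => //=.
    have := GL (D k) x; rewrite (dist1C (D k)) => h.
    have : dist1 x (D k) * (2 * (L + 1)) < t - G x by rewrite -ltr_pdivlMr//; lra.
    have := dist1_ge0 x (D k); nra.
  by move=> [k _] /=; apply: le_lt_trans.
apply: countable_bigcupT_measurable => [|k]; first exact: countableP.
rewrite -[X in measurable X]setTI.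
apply: (@measurable_fun_ltr _ _ _ setT
  (fun x => G (D k) + L * dist1 x (D k)) (cst t)) => //.
apply: measurable_funD => //; apply: measurable_funM => //.
exact: measurable_dist1l.
Qed.

Lemma rho_sqr_perturb x y z : rho x z ^+ 2 <=
  rho y z ^+ 2 + rho x y * (2 * rho y z + rho x y).
Proof.
have := rho_triangle x y z; have := rho_ge0 x y; have := rho_ge0 y z.
have := rho_ge0 x z; nra.
Qed.

Lemma sqdist_perturb n (x y z : n.-tuple X) C :
  (forall i, rho (tnth y i) (tnth z i) <= C) ->
  sqdist x z <= sqdist y z + dist1 x y * (2 * C + dist1 x y).
Proof.
move=> yzC; rewrite /dist1 mulr_suml -/(dist1 x y) /sqdist -big_split /=.
apply: ler_sum => i _; apply: (le_trans (rho_sqr_perturb _ (tnth y i) _)).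
rewrite lerD2l; apply: ler_wpM2l; first exact: rho_ge0.
by apply: lerD (rho_le_dist1 _ _ _); rewrite ler_pM2l.
Qed.

(** Infimum convolution in the last [n] coordinates only; the first one stays a parameter, as the
    induction on the dimension requires. *)
Definition infconv n (G : n.+1.-tuple X -> R) (z : X * n.-tuple X) : R :=
  inf [set G (consp (z.1, y)) + sqdist z.2 y | y in [set: n.-tuple X]].

Section infconv.
Variables (n : nat) (G : n.+1.-tuple X -> R) (K : R).
Hypothesis GK : forall x, `|G x| <= K.

Let infconv_has_lb z :
  has_lbound [set G (consp (z.1, y)) + sqdist z.2 y | y in [set: n.-tuple X]].
Proof.
exists (- K) => _ [y _ <-].
by have := GK (consp (z.1, y)); rewrite ler_norml => /andP[]; have := sqdist_ge0 z.2 y; lra.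
Qed.

Lemma infconv_le x y y' : infconv G (x, y) <= G (consp (x, y')) + sqdist y y'.
Proof. by apply: (@ge_inf _ _ (infconv_has_lb (x, y))); exists y'. Qed.

Lemma le_infconv x y t : (forall y', t <= G (consp (x, y')) + sqdist y y') ->
  t <= infconv G (x, y).
Proof.
by move=> h; apply: lb_le_inf => [|_ [y' _ <-]//]; exists (G (consp (x, y)) + sqdist y y), y.
Qed.

Lemma infconv_bounded z : `|infconv G z| <= K.
Proof.
case: z => x y; rewrite ler_norml; apply/andP; split.
  apply: le_infconv => y'; have := sqdist_ge0 y y'.
  by have := GK (consp (x, y')); rewrite ler_norml => /andP[]; lra.
apply: (le_trans (infconv_le x y y)); rewrite sqdistxx addr0.
by have := GK (consp (x, y)); rewrite ler_norml => /andP[].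
Qed.

(** [G] and [sqdist] vary continuously with the competitor, so the infimum may be taken over a
    countable dense sequence. *)
Lemma measurable_infconv : dist1_lipschitz G -> measurable_fun setT (infconv G).
Proof.
move=> GL; have [D hD] := tuple_separable n.
have mG := measurable_dist1_lipschitz GL.
apply: measurable_fun_lt_set => t.
have -> : [set z | infconv G z < t] =
    \bigcup_k [set z | G (consp (z.1, D k)) + sqdist z.2 (D k) < t].
  apply/seteqP; split => -[x y] /=; last first.
    by move=> [k _] /=; apply: le_lt_trans; exact: infconv_le.
  move=> /inf_lt -[|_ [y' _ <-] /= y't].
    by exists (G (consp (x, y)) + sqdist y y), y.
  have [L L0 hL] := GL.
  set C := dist1 y y'; have C0 : 0 <= C := dist1_ge0 _ _.
  set s := t - (G (consp (x, y')) + sqdist y y').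
  have s0 : 0 < s by rewrite /s; lra.
  (* Moving the competitor by [u < e] costs at most [L * u + u * (2 * C + u)]; the cap 1 gives
     [u * u <= u], and the total stays below the slack [s]. *)
  pose e := Num.min 1 (s / (L + 2 * C + 2)).
  have e0 : 0 < e by rewrite lt_min ltr01 divr_gt0//; lra.
  have [k yk] := hD y' _ e0; exists k => //=.
  have := hL (consp (x, D k)) (consp (x, y')).
  rewrite dist1_cons rhoxx add0r.
  have yC i : rho (tnth y' i) (tnth y i) <= C.
    by rewrite /C dist1C; exact: rho_le_dist1.
  have h := sqdist_perturb (D k) yC.
  rewrite !(sqdistC _ y) (dist1C (D k)) in h *.
  set u := dist1 y' (D k) in yk h *.
  have u0 : 0 <= u := dist1_ge0 _ _.
  move: yk; rewrite lt_min => /andP[u1]; rewrite ltr_pdivlMr; last lra.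
  have uu : u * u <= u by rewrite ler_piMl// ltW.
  by move: h; rewrite /s; lra.
apply: countable_bigcupT_measurable => [|k]; first exact: countableP.
rewrite -[X in measurable X]setTI.
apply: (@measurable_fun_ltr _ _ _ setT
  (fun z : X * n.-tuple X => G (consp (z.1, D k)) + sqdist z.2 (D k)) (cst t)) => //.
apply: measurable_funD.
  apply: (measurableT_comp mG); apply: (measurableT_comp (@measurable_consp _ _ _)).
  by apply/measurable_fun_pair => //.
exact: (@measurableT_comp _ _ _ _ _ _ (@sqdist n ^~ (D k)) _ snd (measurable_sqdistl _)).
Qed.

End infconv.
End separable_metric.

(** * Duality and tensorization *)

Section bounded.
Context {R : realType} {d} {T : measurableType d}.

Lemma bounded_integrable (P : probability T R) (f : T -> R) (K : R) :
  measurable_fun setT f -> (forall x, `|f x| <= K) ->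
  P.-integrable setT (EFin \o f).
Proof.
move=> mf fK; apply: measurable_bounded_integrable => //.
  by rewrite -ge0_fin_numE// fin_num_measure.
exists K; split; first by rewrite num_real.
by move=> M KM x _ /=; exact: le_trans (fK x) (ltW KM).
Qed.

Lemma EFin_Rintegral (P : probability T R) (f : T -> R) :
  P.-integrable setT (EFin \o f) ->
  (\int[P]_x (f x)%:E)%E = (\int[P]_x f x)%:E.
Proof. by move=> fi; rewrite /Rintegral fineK//; exact: integrable_fin_num. Qed.

Lemma bounded_Rintegral (P : probability T R) (f : T -> R) (K : R) :
  measurable_fun setT f -> (forall x, `|f x| <= K) ->
  `|\int[P]_x f x| <= K.
Proof.
move=> mf fK; apply: (le_trans (le_normr_Rintegral _ _)) => //.
  exact: bounded_integrable fK.
apply: (@le_trans _ _ (\int[P]_x cst K x)).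
  apply: le_Rintegral => //.
    by apply: (@bounded_integrable _ _ K) => [|x]; [exact: measurableT_comp|rewrite normr_id].
  exact: finite_measure_integrable_cst.
by rewrite Rintegral_cst// [X in fine X](probability_setT P) mulr1.
Qed.

Lemma Rintegral_prob_cst (P : probability T R) (c : R) : \int[P]_x c = c.
Proof. by rewrite Rintegral_cst// [X in fine X](probability_setT P) mulr1. Qed.

End bounded.

Lemma coupling_fst {R : realType} d (X : measurableType d)
    (nu mu : probability X R) (pi : probability (X * X)%type R) (f : X -> R) (K : R) :
  coupling nu mu pi -> measurable_fun setT f -> (forall x, `|f x| <= K) ->
  \int[pi]_z f z.1 = \int[nu]_x f x.
Proof.
move=> [h _] mf fK; rewrite /Rintegral; congr fine.
transitivity (\int[pushforward pi fst]_x (f x)%:E)%E.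
  rewrite integral_pushforward//; first exact/measurable_EFinP.
  by apply: (@bounded_integrable _ _ _ _ _ K) => //; exact: measurableT_comp.
apply: eq_measure_integral => A mA _; apply: etrans (h A mA).
by congr (pi _); apply/seteqP; split => -[x y] //= -[].
Qed.

Lemma coupling_snd {R : realType} d (X : measurableType d)
    (nu mu : probability X R) (pi : probability (X * X)%type R) (f : X -> R) (K : R) :
  coupling nu mu pi -> measurable_fun setT f -> (forall x, `|f x| <= K) ->
  \int[pi]_z f z.2 = \int[mu]_x f x.
Proof.
move=> [_ h] mf fK; rewrite /Rintegral; congr fine.
transitivity (\int[pushforward pi snd]_x (f x)%:E)%E.
  rewrite integral_pushforward//; first exact/measurable_EFinP.
  by apply: (@bounded_integrable _ _ _ _ _ K) => //; exact: measurableT_comp.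
apply: eq_measure_integral => A mA _; apply: etrans (h A mA).
by congr (pi _); apply/seteqP; split => -[x y] //= -[].
Qed.

(** [Radon_Nikodym] and [g] agree only [mu]-almost everywhere; domination carries this over to [nu],
    against which the logarithm is integrated. *)
Lemma rel_entropy_density {R : realType} d (X : measurableType d)
    (nu mu : probability X R) (g : X -> R) :
  (forall x, 0 <= g x) -> measurable_fun setT g ->
  mu.-integrable setT (EFin \o g) ->
  (forall A, measurable A -> nu A = \int[mu]_(x in A) (g x)%:E)%E ->
  measurable_fun setT (fun x => ln (g x)) ->
  (rel_entropy nu mu = \int[nu]_x (ln (g x))%:E)%E.
Proof.
move=> g0 mg ig nuE mlg.
have num : nu `<< mu.
  apply/null_content_dominatesP => A mA mA0 /=.
  by rewrite nuE//; apply: null_set_integral => //; apply/measurable_funTS/measurable_EFinP.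
rewrite /rel_entropy; case: pselect => // num'.
apply: ae_eq_integral => //.
- apply/measurable_EFinP; apply: measurableT_comp => //.
  apply: measurableT_comp => //.
- exact/measurable_EFinP.
apply: (null_dominates_ae_eq _ num) => //.
have : ae_eq mu setT (Radon_Nikodym (charge_of_finite_measure nu) mu) (EFin \o g).
  apply: integral_ae_eq => //.
  - exact: Radon_Nikodym_integrable.
  - exact/measurable_EFinP.
  - by move=> E _ mE; rewrite -Radon_Nikodym_integral//= nuE.
by apply: filterS => x /= h _; rewrite h.
Qed.

Section dual.
Context {R : realType} {d} {X : measurableType d}.
Variables (rho : X -> X -> R) (mu : probability X R) (a : R).
Hypothesis hrho : polish_borel rho.
Hypothesis a0 : 0 < a.

Lemma transport_cost2_ge (nu : probability X R) (f g : X -> R) (K : R) :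
  measurable_fun setT f -> measurable_fun setT g ->
  (forall x, `|f x| <= K) -> (forall x, `|g x| <= K) ->
  (forall x y, f x - g y <= rho x y ^+ 2) ->
  ((\int[nu]_x f x - \int[mu]_x g x)%:E <= transport_cost2 rho nu mu)%E.
Proof.
move=> mf mg fK gK fg; apply/ereal_infP => _ [pi hpi <-].
have mrho : measurable_fun setT (fun z : X * X => rho z.1 z.2 ^+ 2).
  by apply: measurable_funX; exact: (measurable_rho hrho).
rewrite -(coupling_fst hpi mf fK) -(coupling_snd hpi mg gK).
have i1 : pi.-integrable setT (EFin \o (fun z => f z.1)).
  by apply: (@bounded_integrable _ _ _ _ _ K) => //; exact: measurableT_comp.
have i2 : pi.-integrable setT (EFin \o (fun z => g z.2)).
  by apply: (@bounded_integrable _ _ _ _ _ K) => //; exact: measurableT_comp.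
have i12 : pi.-integrable setT (EFin \o (fun z => f z.1 - g z.2)).
  apply: (@bounded_integrable _ _ _ _ _ (K + K)) => [|z].
    by apply: measurable_funB; exact: measurableT_comp.
  by apply: (le_trans (ler_normB _ _)); exact: lerD.
(* An infinite cost is treated apart because the comparison of integrals below needs an integrable
   cost. *)
have [->|fin] := eqVneq (\int[pi]_z (rho z.1 z.2 ^+ 2)%:E)%E +oo%E.
  exact: leey.
rewrite -RintegralB// -EFin_Rintegral//.
apply: le_integral => //.
- apply/integrableP; split; first exact/measurable_EFinP.
  under eq_integral do rewrite gee0_abs ?lee_fin ?sqr_ge0//.
  by rewrite ltey.
- by move=> z _; rewrite lee_fin.
Qed.

(* Bobkov-Goetze duality; only the trivial half of Kantorovich duality is
   needed, applied to the Gibbs measure with density [e^(a f) / Z]. *)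
Lemma transport_entropy_dual (f g : X -> R) (K : R) :
  (forall nu : probability X R,
     (transport_cost2 rho nu mu <= (a^-1)%:E * rel_entropy nu mu)%E) ->
  measurable_fun setT f -> measurable_fun setT g ->
  (forall x, `|f x| <= K) -> (forall x, `|g x| <= K) ->
  (forall x y, f x - g y <= rho x y ^+ 2) ->
  \int[mu]_x expR (a * f x) <= expR (a * \int[mu]_x g x).
Proof.
move=> T2 mf mg fK gK fg; set Z := \int[mu]_x expR (a * f x).
have maf : measurable_fun setT (fun x => expR (a * f x)).
  by apply: measurableT_comp => //; exact: measurable_funM.
have afK x : `|a * f x| <= a * K.
  by rewrite normrM gtr0_norm// ler_pM2l.
have eK x : `|expR (a * f x)| <= expR (a * K).
  by rewrite gtr0_norm ?expR_gt0// ler_expR; exact: le_trans (ler_norm _) (afK x).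
have ie := bounded_integrable mu maf eK.
have Z0 : 0 < Z.
  apply: (@lt_le_trans _ _ (expR (- (a * K)))); first exact: expR_gt0.
  rewrite -[leLHS](Rintegral_prob_cst mu); apply: le_Rintegral => //.
    exact: finite_measure_integrable_cst.
  by move=> x _; rewrite ler_expR; have := afK x; rewrite ler_norml => /andP[].
pose w x := expR (a * f x) / Z.
have mw : measurable_fun setT w by exact: measurable_funM.
have w0 x : 0 <= w x by rewrite divr_ge0 ?expR_ge0// ltW.
have iw : mu.-integrable setT (EFin \o w).
  apply: (@bounded_integrable _ _ _ mu w (expR (a * K) / Z)) => // x.
  by rewrite normrM (@gtr0_norm _ Z^-1) ?invr_gt0// ler_pM2r ?invr_gt0.
have w1 : (\int[mu]_x (w x)%:E = 1)%E.
  by rewrite (EFin_Rintegral iw) RintegralZr// divff// gt_eqF.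
have [nu [nuE _]] := density_probability w0 mw w1.
have lw x : ln (w x) = a * f x - ln Z.
  by rewrite ln_div ?posrE ?expR_gt0// expRK.
have mlw : measurable_fun setT (fun x => ln (w x)).
  by under eq_fun do rewrite lw; apply: measurable_funB => //; exact: measurable_funM.
have if_ := bounded_integrable nu mf fK.
have Hnu : rel_entropy nu mu = (a * \int[nu]_x f x - ln Z)%:E.
  rewrite (rel_entropy_density w0 mw iw nuE mlw).
  have iaf : nu.-integrable setT (EFin \o (fun x => a * f x)).
    by apply: (bounded_integrable _ _ afK); exact: measurable_funM.
  have ic : nu.-integrable setT (EFin \o cst (ln Z)).
    exact: finite_measure_integrable_cst.
  under eq_integral do rewrite lw.
  rewrite EFin_Rintegral; last first.
    apply: (@bounded_integrable _ _ _ _ _ (a * K + `|ln Z|)) => [|x].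
      by apply: measurable_funB => //; exact: measurable_funM.
    by apply: (le_trans (ler_normB _ _)); exact: lerD.
  by rewrite RintegralB// Rintegral_prob_cst RintegralZl.
(* The integral of [f] under [nu] occurs on both sides, once in the cost bound and once in the
   entropy of the Gibbs measure; it cancels and leaves [ln Z <= a * \int[mu]_x g x]. *)
have := le_trans (transport_cost2_ge nu mf mg fK gK fg) (T2 nu).
rewrite Hnu -EFinM lee_fin mulrBr mulKf ?gt_eqF// lerD2l lerN2.
rewrite ler_pdivrMl// => h.
by rewrite -[Z]lnK ?posrE// ler_expR.
Qed.

End dual.

Section bounded_fubini.
Context {R : realType} {d1 d2} {T1 : measurableType d1} {T2 : measurableType d2}.
Variables (P1 : probability T1 R) (P2 : probability T2 R).
Variables (f : T1 * T2 -> R) (K : R).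
Hypothesis mf : measurable_fun setT f.
Hypothesis fK : forall z, `|f z| <= K.

Let fi : (P1 \x P2)%E.-integrable setT (EFin \o f).
Proof. exact: bounded_integrable fK. Qed.

Lemma bounded_measurable_sectionl y : measurable_fun setT (fun x => f (x, y)).
Proof. exact: (measurableT_comp mf (measurable_pair2 y)). Qed.

Let fubini_GE y : fubini_G P1 (EFin \o f) y = (\int[P1]_x f (x, y))%:E.
Proof.
rewrite /fubini_G EFin_Rintegral//.
by apply: (@bounded_integrable _ _ _ _ _ K) => //; exact: bounded_measurable_sectionl.
Qed.

Lemma measurable_bounded_Rintegral :
  measurable_fun setT (fun y => \int[P1]_x f (x, y)).
Proof.
apply/measurable_EFinP; have := measurable_fubini_G fi.
by congr (measurable_fun _ _); apply/funext => y; rewrite fubini_GE.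
Qed.

Lemma bounded_fubini :
  \int[(P1 \x P2)%E]_z f z = \int[P2]_y \int[P1]_x f (x, y).
Proof.
rewrite {1}/Rintegral -(integral21_prod_meas1 fi) /Rintegral.
by congr fine; apply: eq_integral => y _; exact: fubini_GE.
Qed.

End bounded_fubini.

Lemma bounded_Rintegral_powerS {R : realType} d (X : measurableType d)
    (mu : probability X R) n (f : n.+1.-tuple X -> R) (K : R) :
  measurable_fun setT f -> (forall x, `|f x| <= K) ->
  \int[power_measure mu n.+1]_x f x =
  \int[power_measure mu n]_y \int[mu]_x f (consp (x, y)).
Proof.
move=> mf fK.
have mfc : measurable_fun setT (f \o @consp d X n).
  exact: (measurableT_comp mf (@measurable_consp _ _ _)).
rewrite -(bounded_fubini mu (power_measure mu n) mfc (fun z => fK _)).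
rewrite /Rintegral; congr fine.
transitivity (\int[pushforward (mu \x power_measure mu n) (@consp d X n)]_x (f x)%:E)%E.
  apply: eq_measure_integral; first exact: measurable_consp.
  by move=> ? A mA _; exact: (power_measureS mu).
rewrite integral_pushforward//; first exact: measurable_consp.
  exact/measurable_EFinP.
exact: (@bounded_integrable _ _ _ _ _ K).
Qed.

Section tensorization.
Context {R : realType} {d} {X : measurableType d}.
Variables (rho : X -> X -> R) (mu : probability X R) (a : R).
Hypothesis hrho : polish_borel rho.
Hypothesis a0 : 0 < a.
Hypothesis T2 : forall nu : probability X R,
  (transport_cost2 rho nu mu <= (a^-1)%:E * rel_entropy nu mu)%E.

(* The Lipschitz condition on [G] is there to make [infconv G] measurable, and is
   preserved by integrating out one coordinate. *)
Lemma power_dual n (F G : n.-tuple X -> R) (K : R) :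
  measurable_fun setT F -> dist1_lipschitz rho G ->
  (forall x, `|F x| <= K) -> (forall x, `|G x| <= K) ->
  (forall x y, F x - G y <= sqdist rho x y) ->
  \int[power_measure mu n]_x expR (a * F x) <=
  expR (a * \int[power_measure mu n]_x G x).
Proof.
elim: n F G => [|n IH] F G mF GL FK GK FG.
  have FE : F = cst (F [tuple]) by apply/funext => x; rewrite (tuple0 x).
  have GE : G = cst (G [tuple]) by apply/funext => x; rewrite (tuple0 x).
  rewrite FE GE /= !Rintegral_prob_cst ler_expR ler_pM2l//.
  by have := FG [tuple] [tuple]; rewrite sqdistxx// subr_le0.
have mG := measurable_dist1_lipschitz hrho GL.
have mcons y : measurable_fun setT (fun x : X => consp (x, y) : n.+1.-tuple X).
  exact: (measurableT_comp (@measurable_consp _ _ _) (measurable_pair2 y)).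
pose h := infconv rho G.
have mh : measurable_fun setT h := measurable_infconv hrho GK GL.
have hK z : `|h z| <= K := infconv_bounded hrho GK z.
have mhy y := bounded_measurable_sectionl mh y.
(* [h] splits the constraint in two: [F] against [h] in the first coordinate, [H] against [G'] in
   the remaining ones. *)
pose H y := \int[mu]_x h (x, y).
pose G' y := \int[mu]_x G (consp (x, y)).
have mH : measurable_fun setT H := measurable_bounded_Rintegral mu (power_measure mu n) mh hK.
have HK y : `|H y| <= K by exact: bounded_Rintegral.
have mGy y : measurable_fun setT (fun x => G (consp (x, y))).
  exact: (measurableT_comp mG (mcons y)).
have G'K y : `|G' y| <= K by exact: bounded_Rintegral.
have ihy y := bounded_integrable mu (mhy y) (fun x => hK (x, y)).
have iGy y := bounded_integrable mu (mGy y) (fun x => GK (consp (x, y))).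
have G'D y c : \int[mu]_x (G (consp (x, y)) + c) = G' y + c.
  rewrite RintegralD ?Rintegral_prob_cst//.
  exact: finite_measure_integrable_cst.
have iGD y c : mu.-integrable setT (EFin \o (fun x => G (consp (x, y)) + c)).
  apply: (@bounded_integrable _ _ _ _ _ (K + `|c|)) => [|x].
    exact: measurable_funD.
  by apply: (le_trans (ler_normD _ _)); rewrite lerD2r.
have G'L : dist1_lipschitz rho G'.
  have [L L0 hL] := GL; exists L => // y y'; rewrite -G'D.
  apply: le_Rintegral => // x _; apply: (le_trans (hL _ (consp (x, y')))).
  by rewrite dist1_cons rhoxx// add0r.
(* The same competitor [y'] is used in the infimum defining [h (x, y)] for every [x] under the
   integral. *)
have HG y y' : H y - G' y' <= sqdist rho y y'.
  rewrite lerBlDl -G'D; apply: le_Rintegral => // x _.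
  exact: (infconv_le rho GK).
have maF : measurable_fun setT (fun x => expR (a * F x)).
  by apply: measurableT_comp => //; exact: measurable_funM.
have eK (r : R) : `|r| <= K -> `|expR (a * r)| <= expR (a * K).
  move=> rK; rewrite gtr0_norm ?expR_gt0// ler_expR ler_pM2l//.
  exact: le_trans (ler_norm _) rK.
rewrite (bounded_Rintegral_powerS mu maF (fun x => eK _ (FK x))).
rewrite (bounded_Rintegral_powerS mu mG GK).
apply: le_trans (IH H G' mH G'L HK G'K HG).
have mFc : measurable_fun setT (fun z => expR (a * F (@consp d X n z))).
  exact: (measurableT_comp maF (@measurable_consp _ _ _)).
apply: le_Rintegral => //.
- apply: (@bounded_integrable _ _ _ _ _ (expR (a * K))) => [|y].
    exact: (measurable_bounded_Rintegral mu (power_measure mu n) mFc (fun z => eK _ (FK _))).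
  apply: (bounded_Rintegral mu _ (fun x => eK _ (FK (consp (x, y))))).
  exact: (measurableT_comp maF (mcons y)).
- apply: (@bounded_integrable _ _ _ _ _ (expR (a * K))) => [|y].
    by apply: measurableT_comp => //; exact: measurable_funM.
  exact: eK.
(* With [y] frozen, the one-coordinate inequality bounds the inner integral by [expR (a * H y)]. *)
move=> y _; apply: (transport_entropy_dual hrho a0 (K := K)) => //.
  exact: (measurableT_comp mF (mcons y)).
move=> x x'; rewrite lerBlDr addrC -lerBlDr; apply: le_infconv => y'.
have := FG (consp (x, y)) (consp (x', y')); rewrite sqdist_cons.
by lra.
Qed.

End tensorization.

(** * Concentration from the transport inequality *)

Section truncated_distance.
Context {R : realType} {d} {X : measurableType d}.
Variable rho : X -> X -> R.
Hypothesis hrho : polish_borel rho.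
Variables (n : nat) (A : set (n.-tuple X)) (K : R).
Hypothesis A0 : A !=set0.
Hypothesis K0 : 0 <= K.

(** Truncation makes the squared distance to [A] bounded, as the dual inequality requires, and also
    Lipschitz for [dist1], which a squared distance need not be globally. *)
Definition tdist (x : n.-tuple X) : R :=
  Num.min (inf [set sqdist rho x z | z in A]) K.

Let has_lb x : has_lbound [set sqdist rho x z | z in A].
Proof. by exists 0 => _ [z _ <-]; exact: sqdist_ge0. Qed.

Let ne x : [set sqdist rho x z | z in A] !=set0.
Proof. by case: A0 => z Az; exists (sqdist rho x z), z. Qed.

Lemma tdist_ge0 x : 0 <= tdist x.
Proof.
rewrite le_min K0 andbT; apply: lb_le_inf => // _ [z _ <-]; exact: sqdist_ge0.
Qed.

Lemma tdist_leK x : tdist x <= K.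
Proof. by rewrite ge_min lexx orbT. Qed.

Lemma tdist_le x z : A z -> tdist x <= sqdist rho x z.
Proof.
by move=> Az; rewrite ge_min; apply/orP; left; apply: ge_inf => //; exists z.
Qed.

Lemma tdist_lt x t : tdist x < t -> t <= K -> exists2 z, A z & sqdist rho x z < t.
Proof.
rewrite gt_min => /orP[/inf_lt -[//|_ [z Az <-] zt] _|Kt tK]; first by exists z.
by have := lt_le_trans Kt tK; rewrite ltxx.
Qed.

Lemma tdist_lipschitz : dist1_lipschitz rho tdist.
Proof.
have K0' := K0; have L0 : 0 <= 2 * K + 3 by lra.
(* This bounds [2 * C + dist1 x y] for [C = K + 1] and [dist1 x y < 1]; when [dist1 x y >= 1] the
   bound [tdist x <= K] suffices. A squared distance below [K] keeps each coordinate distance below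
   [K + 1]. *)
exists (2 * K + 3) => // x y.
have d0 := dist1_ge0 hrho x y.
have Kd : 0 <= K * dist1 rho x y by rewrite mulr_ge0.
have yx0 := tdist_ge0 y; have xK := tdist_leK x.
have [yK|yK] := leP K (tdist y); first by nra.
have [d1|d1] := leP 1 (dist1 rho x y); first by nra.
apply/ler_addgt0Pr => e e0.
have h1 : tdist y < Num.min (tdist y + e) K by rewrite lt_min yK andbT ltrDl.
have h2 : Num.min (tdist y + e) K <= K by rewrite ge_min lexx orbT.
have [z Az zt] := tdist_lt h1 h2.
move: zt; rewrite lt_min => /andP[z1 z2].
have yC i : rho (tnth y i) (tnth z i) <= K + 1.
  have := rho_sqr_le_sqdist rho y z i; have := rho_ge0 hrho (tnth y i) (tnth z i).
  by nra.
apply: (le_trans (tdist_le x Az)).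
have := sqdist_perturb hrho x yC; nra.
Qed.

(** Young's inequality [(1 - s) * (u + v)^2 <= u^2 + (1 - s) / s * v^2] in each coordinate, the
    difference being a square divided by [s]. Where [tdist y] is saturated at [K], the left side is
    nonpositive since [s^-1 >= 1]. *)
Lemma tdist_quasi_triangle s x y : 0 < s -> s < 1 ->
  (1 - s) * tdist x - (1 - s) / s * tdist y <= sqdist rho x y.
Proof.
move=> s0 s1; have s2 : 0 < 1 - s by rewrite subr_gt0.
have s3 : 1 <= s^-1 by rewrite invf_ge1// ltW.
have xK := tdist_leK x; have xy0 := sqdist_ge0 rho x y.
have [yK|yK] := leP K (tdist y).
  have h : tdist x <= s^-1 * tdist y.
    apply: (le_trans xK); apply: (le_trans yK).
    by rewrite ler_peMl// (le_trans K0).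
  rewrite -mulrA -mulrBr; apply: le_trans xy0.
  by rewrite pmulr_rle0// subr_le0.
apply/ler_addgt0Pr => e e0.
have c0 : 0 < (1 - s) / s by rewrite divr_gt0.
have h1 : tdist y < Num.min (tdist y + e / ((1 - s) / s)) K.
  by rewrite lt_min yK andbT ltrDl divr_gt0.
have h2 : Num.min (tdist y + e / ((1 - s) / s)) K <= K by rewrite ge_min lexx orbT.
have [z Az zt] := tdist_lt h1 h2.
move: zt; rewrite lt_min => /andP[z1 _].
have {z1} z1 : (1 - s) / s * sqdist rho y z <= (1 - s) / s * tdist y + e.
  have := ltW z1; rewrite -(ler_pM2l c0) mulrDr [_ * (e / _)]mulrC divfK//.
  by rewrite gt_eqF.
have := tdist_le x Az; rewrite -(ler_pM2l s2) => z2.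
suff : (1 - s) * sqdist rho x z <= (1 - s) / s * sqdist rho y z + sqdist rho x y by lra.
rewrite /sqdist !mulr_sumr -big_split /=; apply: ler_sum => i _.
set u := rho (tnth x i) (tnth y i); set v := rho (tnth y i) (tnth z i).
have u0 : 0 <= u by exact: rho_ge0. have v0 : 0 <= v by exact: rho_ge0.
have w0 := rho_ge0 hrho (tnth x i) (tnth z i).
have wuv : rho (tnth x i) (tnth z i) <= u + v by exact: rho_triangle.
apply: (@le_trans _ _ ((1 - s) * (u + v) ^+ 2)).
  by rewrite ler_pM2l// lerXn2r// nnegrE// addr_ge0.
rewrite -subr_ge0.
have -> : (1 - s) / s * v ^+ 2 + u ^+ 2 - (1 - s) * (u + v) ^+ 2 =
  (s * u - (1 - s) * v) ^+ 2 / s by field; rewrite gt_eqF.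
by rewrite divr_ge0 ?sqr_ge0 ?ltW.
Qed.

End truncated_distance.

Section concentration.
Context {R : realType} {d} {X : measurableType d}.
Variables (rho : X -> X -> R) (mu : probability X R) (a : R).
Hypothesis hrho : polish_borel rho.
Hypothesis a0 : 0 < a.
Hypothesis T2 : forall nu : probability X R,
  (transport_cost2 rho nu mu <= (a^-1)%:E * rel_entropy nu mu)%E.

(** The first dual bound says that [r0 ^+ 2] dominates the mean of the truncated squared distance to
    [A]; [ln 2] comes from the mass 1/2 of [A]. *)
Let r0 := Num.sqrt (ln 2 / a).

Let ln2_gt0 : 0 < ln 2 :> R. Proof. by rewrite ln_gt0// ltr1n. Qed.
Let r0_gt0 : 0 < r0. Proof. by rewrite sqrtr_gt0 divr_gt0. Qed.
Let ar0 : a * r0 ^+ 2 = ln 2.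
Proof. by rewrite sqr_sqrtr ?divr_ge0 ?ltW// mulrC divfK// gt_eqF. Qed.

Variables (n : nat) (A : set (n.-tuple X)).
Hypothesis mA : measurable A.
Let P := power_measure mu n.
Hypothesis PA : ((2^-1)%:E <= P A)%E.

Let A0 : A !=set0.
Proof.
apply/set0P/eqP => AE; move: PA; rewrite AE measure0 lee_fin.
by rewrite leNgt invr_gt0 ltr0n.
Qed.

(* Dual inequality for the pair [- K * \1_(~` A)], [- tdist]. *)
Lemma Rintegral_tdist_le K : 0 <= K -> a * \int[P]_x tdist rho A K x <= ln 2.
Proof.
move=> K0; have mphi := measurable_dist1_lipschitz hrho (tdist_lipschitz hrho A0 K0).
pose F x : R := - K * \1_(~` A) x.
have mF : measurable_fun setT F.
  by apply: measurable_funM => //; apply: measurable_indic; exact: measurableC.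
have FK x : `|F x| <= K.
  rewrite /F indicE; case: (x \in _); rewrite ?mulr1 ?mulr0 ?normr0//.
  by rewrite normrN ger0_norm.
have GK x : `|- tdist rho A K x| <= K.
  by rewrite normrN ger0_norm ?tdist_leK// tdist_ge0.
have [L L0 hL] := tdist_lipschitz hrho A0 K0.
have GL : dist1_lipschitz rho (fun x => - tdist rho A K x).
  by exists L => // x y; have := hL y x; rewrite (dist1C hrho y x); lra.
have FG x y : F x - - tdist rho A K y <= sqdist rho x y.
  rewrite opprK /F indicE; have := tdist_leK rho A K y; have := sqdist_ge0 rho x y.
  have [/set_mem Ax|] := boolP (x \in A).
    rewrite in_setC mem_set//= mulr0 add0r => _ _.
    by rewrite sqdistC//; exact: tdist_le.
  by move=> Ax; rewrite in_setC Ax mulr1; lra.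
have := power_dual hrho a0 T2 mF GL FK GK FG.
have iphi : P.-integrable setT (EFin \o tdist rho A K).
  apply: (@bounded_integrable _ _ _ _ _ K) => // x.
  by have := GK x; rewrite normrN.
have -> : \int[P]_x (- tdist rho A K x) = - \int[P]_x tdist rho A K x.
  by under eq_Rintegral do rewrite -mulN1r; rewrite RintegralZl// mulN1r.
move=> h.
(* [F] vanishes on [A], so the exponential is 1 there and the mass of [A] is a lower bound. *)
have h2 : 2^-1 <= \int[P]_x expR (a * F x).
  rewrite -lee_fin; apply: (le_trans PA).
  rewrite -EFin_Rintegral; last first.
    apply: (@bounded_integrable _ _ _ _ _ (expR (a * K))) => [|x].
      by apply: measurableT_comp => //; exact: measurable_funM.
    rewrite gtr0_norm ?expR_gt0// ler_expR ler_pM2l//.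
    exact: le_trans (ler_norm _) (FK x).
  rewrite -[P A]mul1e -(integral_cst P mA) integral_mkcond.
  apply: ge0_le_integral => //.
  - by move=> x _; rewrite patchE; case: ifP.
  - by apply: (measurable_restrictT (cst 1%E) mA).1; exact: measurable_cst.
  - apply/measurable_EFinP; apply: measurableT_comp => //; exact: measurable_funM.
  move=> x _; rewrite patchE; case: ifPn => Ax; last by rewrite lee_fin expR_ge0.
  by rewrite lee_fin /F indicE in_setC Ax !mulr0 expR0.
have := le_trans h2 h; rewrite -{1}[2^-1]lnK ?posrE ?invr_gt0// ler_expR lnV ?posrE//.
by lra.
Qed.

Lemma concentration_lt r : r0 < r ->
  (P [set x | (r ^+ 2 <= tdist rho A (r ^+ 2) x)%R] <=
   (expR (- a * (r - r0) ^+ 2))%:E)%E.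
Proof.
move=> r0r; have rgt0 : 0 < r by exact: lt_trans r0r.
have K0 : 0 <= r ^+ 2 by exact: sqr_ge0.
(* [s = r0 / r] optimizes [(1 - s) / s * ln 2 - a (1 - s) r^2]. *)
pose s := r0 / r; have s0 : 0 < s by rewrite divr_gt0.
have s1 : s < 1 by rewrite ltr_pdivrMr// mul1r.
have s2 : 0 < 1 - s by rewrite subr_gt0.
have phiL := tdist_lipschitz hrho A0 K0.
have mphi := measurable_dist1_lipschitz hrho phiL.
set phi := tdist rho A (r ^+ 2) in phiL mphi *.
have phi0 x : 0 <= phi x by exact: tdist_ge0.
have phiK x : phi x <= r ^+ 2 by exact: tdist_leK.
have iphi : P.-integrable setT (EFin \o phi).
  by apply: (@bounded_integrable _ _ _ _ _ (r ^+ 2)) => // x; rewrite ger0_norm.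
have c0 : 0 < (1 - s) / s by rewrite divr_gt0.
(* [power_dual] takes one bound for both functions; this makes [(1 - s) / s * r ^+ 2] serve for
   each. *)
have cs : 1 - s <= (1 - s) / s by rewrite ler_pMr// invf_ge1// ltW.
have h := @power_dual _ _ _ rho mu a hrho a0 T2 n (fun x => (1 - s) * phi x)
  (fun x => (1 - s) / s * phi x) ((1 - s) / s * r ^+ 2) _ _ _ _ _.
have {}h : \int[P]_x expR (a * ((1 - s) * phi x)) <= expR ((1 - s) / s * ln 2).
  apply: le_trans (h _ _ _ _ _) _.
  - exact: measurable_funM.
  - have [L L0 hL] := phiL; exists ((1 - s) / s * L) => [|x y].
      by apply: mulr_ge0 => //; exact: ltW.
    by rewrite -[_ * L * _]mulrA -mulrDr ler_pM2l.
  - move=> x; rewrite ger0_norm; last by apply: mulr_ge0 => //; exact: ltW.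
    by apply: ler_pM => //; exact: ltW.
  - move=> x; rewrite ger0_norm; last by apply: mulr_ge0 => //; exact: ltW.
    by rewrite ler_pM2l.
  - by move=> x y; exact: tdist_quasi_triangle.
  rewrite ler_expR RintegralZl// mulrCA ler_pM2l//.
  exact: Rintegral_tdist_le.
set S := [set x | (r ^+ 2 <= phi x)%R].
have mS : measurable S.
  rewrite -[X in measurable X]setTI.
  by apply: (@measurable_fun_ler _ _ _ setT (cst (r ^+ 2)) phi).
have mexp : measurable_fun setT (fun x => expR (a * ((1 - s) * phi x))).
  by apply: measurableT_comp => //; do 2 apply: measurable_funM => //.
have h1 : ((expR (a * ((1 - s) * r ^+ 2)))%:E * P S <=
    (expR ((1 - s) / s * ln 2))%:E)%E.
  apply: (@le_trans _ _ (\int[P]_x expR (a * ((1 - s) * phi x)))%:E).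
    rewrite -EFin_Rintegral; last first.
      apply: (@bounded_integrable _ _ _ _ _ (expR (a * ((1 - s) * r ^+ 2)))) => // x.
      by rewrite gtr0_norm ?expR_gt0// ler_expR !ler_pM2l.
    rewrite -(integral_cst P mS) integral_mkcond.
    apply: ge0_le_integral => //.
    - by move=> x _; rewrite patchE; case: ifP => // _; rewrite lee_fin expR_ge0.
    - by apply: (measurable_restrictT (cst _) mS).1; exact: measurable_cst.
    - exact/measurable_EFinP.
    move=> x _; rewrite patchE; case: ifPn => [/set_mem Sx|_].
      by rewrite lee_fin ler_expR !ler_pM2l.
    by rewrite lee_fin expR_ge0.
  by rewrite lee_fin.
have -> : - a * (r - r0) ^+ 2 = (1 - s) / s * ln 2 - a * ((1 - s) * r ^+ 2).
  by rewrite -ar0 /s; field; rewrite !gt_eqF.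
by rewrite expRB mulrC EFinM lee_pdivlMl ?expR_gt0.
Qed.

(** The enlargement contains the measurable set where [tdist < r ^+ 2], so every measurable cover
    has at least the measure of that set. *)
Lemma concentration r : r0 <= r ->
  (outer P (enlarge rho A r) >= (1 - 1 * expR (- a * (r - r0) ^+ 2))%:E)%E.
Proof.
(* At [r = r0], where the parameter [s] would be 1, the claimed lower bound is 0. *)
rewrite le_eqVlt => /predU1P[<-|r0r].
  rewrite subrr expr0n mulr0 expR0 mulr1 subrr; apply/ereal_infP => _ [B _ <-].
  exact: measure_ge0.
apply/ereal_infP => _ [B [mB AB] <-].
have rgt0 : 0 < r by exact: lt_trans r0r.
have K0 : 0 <= r ^+ 2 by exact: sqr_ge0.
have mphi := measurable_dist1_lipschitz hrho (tdist_lipschitz hrho A0 K0).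
set S := [set x | (r ^+ 2 <= tdist rho A (r ^+ 2) x)%R].
have mS : measurable S.
  rewrite -[X in measurable X]setTI.
  by apply: (@measurable_fun_ler _ _ _ setT (cst (r ^+ 2)) (tdist rho A (r ^+ 2))).
apply: (@le_trans _ _ (P (~` S))); last first.
  apply: le_measure; rewrite ?inE//; first exact: measurableC.
  move=> x /negP; rewrite -ltNge => /tdist_lt -/(_ A0 (lexx _))[z Az xz].
  apply: AB; exists z => //.
  apply: le_trans (ler_wsqrtr (ltW xz)) _.
  by rewrite sqrtr_sqr ger0_norm; [exact: lexx|exact: ltW].
rewrite probability_setC// mul1r EFinB; apply: leeB => //.
exact: concentration_lt.
Qed.

End concentration.

(** * Weak law of large numbers *)

Lemma integral_prob_cst {R : realType} d (T : measurableType d)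
    (P : probability T R) (c : R) : (\int[P]_x c%:E = c%:E)%E.
Proof. by rewrite integral_cst// [X in (_ * X)%E](probability_setT P) mule1. Qed.

Lemma markov_ineq {R : realType} d (T : measurableType d) (P : probability T R)
    (g : T -> R) (t c : R) :
  measurable_fun setT g -> (forall x, 0 <= g x) -> 0 < t ->
  (\int[P]_x (g x)%:E <= c%:E)%E ->
  (P [set x | (t <= g x)%R] <= (c / t)%:E)%E.
Proof.
move=> mg g0 t0 gc; rewrite mulrC EFinM lee_pdivlMl//.
have mge : measurable_fun setT (EFin \o g) by exact/measurable_EFinP.
have := le_integral_abse P measurableT mge t0; rewrite setTI.
have -> : [set x | (t%:E <= `|(EFin \o g) x|)%E] = [set x | t <= g x].
  by apply/seteqP; split => x /=; rewrite lee_fin ger0_norm.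
move=> /le_trans; apply; apply: le_trans gc.
by under eq_integral do rewrite /= ger0_norm//.
Qed.

(** From [expR (- u) >= 1 - u] follows [expR u <= (1 - u)^-1], and the rest is polynomial. *)
Lemma expR_le_quadratic {R : realType} (u : R) : `|u| <= 2^-1 ->
  expR u <= 1 + u + 2 * u ^+ 2.
Proof.
rewrite ler_norml => /andP[u1 u2].
have h : 0 < 1 - u by lra.
have := expR_ge1Dx (- u); rewrite expRN => h1.
have : expR u <= (1 - u)^-1.
  by rewrite -[leLHS]invrK lef_pV2// ?posrE ?invr_gt0 ?expR_gt0.
move=> /le_trans; apply; rewrite -[leLHS]mul1r ler_pdivrMr//.
rewrite -subr_ge0.
have -> : (1 + u + 2 * u ^+ 2) * (1 - u) - 1 = u ^+ 2 * (1 - 2 * u) by ring.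
by rewrite mulr_ge0 ?sqr_ge0//; lra.
Qed.

Section power_integrals.
Context {R : realType} {d} {X : measurableType d}.
Variable mu : probability X R.

Lemma measurable_tnth_comp n (g : X -> R) (i : 'I_n) :
  measurable_fun setT g -> measurable_fun setT (fun x : n.-tuple X => g (tnth x i)).
Proof. by move=> mg; exact: (measurableT_comp mg (measurable_tnth i)). Qed.

Lemma measurable_sum_tnth n (g : X -> R) : measurable_fun setT g ->
  measurable_fun setT (fun x : n.-tuple X => \sum_(i < n) g (tnth x i)).
Proof. by move=> mg; apply: (measurable_sum _) => i; exact: measurable_tnth_comp. Qed.

Lemma measurable_prod_tnth n (g : X -> R) : measurable_fun setT g ->
  measurable_fun setT (fun x : n.-tuple X => \prod_(i < n) g (tnth x i)).
Proof. by move=> mg; apply: measurable_prod => i _; exact: measurable_tnth_comp. Qed.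

Lemma measurable_prod_consp n (g : X -> R) : measurable_fun setT g ->
  measurable_fun setT (fun z : X * n.-tuple X =>
    (\prod_(i < n.+1) g (tnth (consp z) i))%:E).
Proof.
move=> mg; apply/measurable_EFinP.
exact: (measurableT_comp (@measurable_prod_tnth n.+1 _ mg) (@measurable_consp _ _ _)).
Qed.

Lemma measurable_sum_consp n (g : X -> R) : measurable_fun setT g ->
  measurable_fun setT (fun z : X * n.-tuple X =>
    (\sum_(i < n.+1) g (tnth (consp z) i))%:E).
Proof.
move=> mg; apply/measurable_EFinP.
exact: (measurableT_comp (@measurable_sum_tnth n.+1 _ mg) (@measurable_consp _ _ _)).
Qed.

Lemma measurable_ge_sum n (g : X -> R) t : measurable_fun setT g ->
  measurable [set x : n.-tuple X | t <= \sum_(i < n) g (tnth x i)].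
Proof.
move=> mg; rewrite -[X in measurable X]setTI.
apply: (@measurable_fun_ler _ _ _ setT (cst t)
  (fun x : n.-tuple X => \sum_(i < n) g (tnth x i))) => //.
exact: measurable_sum_tnth.
Qed.

Lemma integral_power_prod n (g : X -> R) (c : R) :
  measurable_fun setT g -> (forall x, 0 <= g x) -> 0 <= c ->
  (\int[mu]_x (g x)%:E <= c%:E)%E ->
  (\int[power_measure mu n]_x (\prod_(i < n) g (tnth x i))%:E <= (c ^+ n)%:E)%E.
Proof.
move=> mg g0 c0 gc; have p0 k (y : k.-tuple X) : 0 <= \prod_(i < k) g (tnth y i).
  by apply: prodr_ge0.
elim: n => [|n IH].
  under eq_integral do rewrite big_ord0.
  by rewrite integral_prob_cst expr0.
rewrite ge0_integral_powerS//; last first.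
- by move=> x; rewrite lee_fin.
- by apply/measurable_EFinP; exact: measurable_prod_tnth.
apply: (@le_trans _ _ (\int[power_measure mu n]_y
    (c%:E * (\prod_(i < n) g (tnth y i))%:E))%E).
  apply: ge0_le_integral => //.
  - by move=> y _; apply: integral_ge0 => x _; rewrite lee_fin.
  - apply: (measurable_fun_fubini_tonelli_G
      (fun z => (\prod_(i < n.+1) g (tnth (consp z) i))%:E)) => [|z].
      exact: measurable_prod_consp.
    by rewrite lee_fin.
  - by apply: measurable_funeM; apply/measurable_EFinP; exact: measurable_prod_tnth.
  move=> y _.
  apply: (@le_trans _ _ ((\int[mu]_x (g x)%:E) * (\prod_(i < n) g (tnth y i))%:E)%E).
    rewrite -ge0_integralZr ?lee_fin//; last 2 first.
    - exact/measurable_EFinP.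
    - by move=> x _; rewrite lee_fin.
    rewrite le_eqVlt; apply/orP; left; apply/eqP; apply: eq_integral => x _.
    rewrite big_ord_recl EFinM; congr (_ * _%:E)%E.
    by apply: eq_bigr => i _; rewrite tnthS.
  by rewrite lee_wpmul2r// lee_fin.
rewrite ge0_integralZl//.
- by rewrite exprS EFinM lee_wpmul2l// lee_fin.
- by apply/measurable_EFinP; exact: measurable_prod_tnth.
- by move=> x _; rewrite lee_fin.
Qed.

Lemma integral_power_sum n (g : X -> R) (c : R) :
  measurable_fun setT g -> (forall x, 0 <= g x) ->
  (\int[mu]_x (g x)%:E <= c%:E)%E ->
  (\int[power_measure mu n]_x (\sum_(i < n) g (tnth x i))%:E <= (n%:R * c)%:E)%E.
Proof.
move=> mg g0 gc; have p0 k (y : k.-tuple X) : 0 <= \sum_(i < k) g (tnth y i).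
  by apply: sumr_ge0.
elim: n => [|n IH].
  under eq_integral do rewrite big_ord0.
  by rewrite integral0 mul0r.
rewrite ge0_integral_powerS//; last first.
- by move=> x; rewrite lee_fin.
- by apply/measurable_EFinP; exact: measurable_sum_tnth.
apply: (@le_trans _ _ (\int[power_measure mu n]_y
    (c%:E + (\sum_(i < n) g (tnth y i))%:E))%E).
  have c0 : 0 <= c.
    by rewrite -lee_fin; apply: le_trans gc; apply: integral_ge0 => x _; rewrite lee_fin.
  apply: ge0_le_integral => //.
  - by move=> y _; apply: integral_ge0 => x _; rewrite lee_fin.
  - apply: (measurable_fun_fubini_tonelli_G
      (fun z => (\sum_(i < n.+1) g (tnth (consp z) i))%:E)) => [|z].
      exact: measurable_sum_consp.
    by rewrite lee_fin.
  - by apply: emeasurable_funD => //; apply/measurable_EFinP; exact: measurable_sum_tnth.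
  move=> y _.
  apply: (@le_trans _ _ ((\int[mu]_x (g x)%:E) + (\sum_(i < n) g (tnth y i))%:E)%E).
    rewrite -[X in (_ <= _ + X)%E](integral_prob_cst mu).
    rewrite -ge0_integralD//; last by move=> x _; rewrite lee_fin.
    - rewrite le_eqVlt; apply/orP; left; apply/eqP; apply: eq_integral => x _.
      rewrite big_ord_recl EFinD; congr (_ + _%:E)%E.
      by apply: eq_bigr => i _; rewrite tnthS.
    - by move=> x _; rewrite lee_fin.
    - exact/measurable_EFinP.
  by rewrite leeD2r.
rewrite ge0_integralD//.
- rewrite integral_prob_cst.
  by rewrite -natr1 mulrDl mul1r EFinD [leRHS]addeC leeD2l.
- move=> x _; apply: le_trans gc; apply: integral_ge0 => y _.
  by rewrite lee_fin.
- by move=> x _; rewrite lee_fin.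
- by apply/measurable_EFinP; exact: measurable_sum_tnth.
Qed.

End power_integrals.

Lemma power_density {R : realType} d (X : measurableType d)
    (nu mu : probability X R) (f : X -> R) :
  (forall x, 0 <= f x) -> measurable_fun setT f ->
  (forall phi : X -> \bar R, (forall x, 0 <= phi x)%E -> measurable_fun setT phi ->
    \int[nu]_x phi x = \int[mu]_x (phi x * (f x)%:E))%E ->
  forall n (G : n.-tuple X -> \bar R), (forall x, 0 <= G x)%E ->
    measurable_fun setT G ->
    (\int[power_measure nu n]_x G x =
     \int[power_measure mu n]_x (G x * (\prod_(i < n) f (tnth x i))%:E))%E.
Proof.
move=> f0 mf hf; have p0 k (y : k.-tuple X) : 0 <= \prod_(i < k) f (tnth y i).
  by apply: prodr_ge0.
elim => [|n IH] G G0 mG.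
  by apply: eq_integral => x _; rewrite big_ord0 mule1.
have mGf : measurable_fun setT (fun z : X * n.-tuple X => (G (consp z) * (f z.1)%:E)%E).
  apply: emeasurable_funM; first exact: (measurableT_comp mG (@measurable_consp _ _ _)).
  by apply/measurable_EFinP; exact: measurableT_comp.
have Gf0 z : (0 <= G (consp z) * (f z.1)%:E)%E by rewrite mule_ge0// lee_fin.
rewrite !ge0_integral_powerS//; last first.
- by move=> x; rewrite mule_ge0// lee_fin.
- by apply: emeasurable_funM => //; apply/measurable_EFinP; exact: measurable_prod_tnth.
transitivity (\int[power_measure nu n]_y \int[mu]_x (G (consp (x, y)) * (f x)%:E))%E.
  apply: eq_integral => y _; apply: hf => //.
  apply: (measurableT_comp mG).
  exact: (measurableT_comp (@measurable_consp _ _ _) (measurable_pair2 y)).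
rewrite IH.
- apply: eq_integral => y _.
  rewrite -ge0_integralZr ?lee_fin//.
  + apply: eq_integral => x _; rewrite big_ord_recl EFinM muleA.
    by under [in RHS]eq_bigr do rewrite tnthS.
  + exact: (measurableT_comp mGf (measurable_pair2 y)).
- by move=> y; apply: integral_ge0 => x _; exact: (Gf0 (x, y)).
- exact: (measurable_fun_fubini_tonelli_G
    (fun z => (G (consp z) * (f z.1)%:E)%E)).
Qed.

Section weak_law.
Context {R : realType} {d} {X : measurableType d}.
Variable mu : probability X R.

Lemma mgf_bound (psi : X -> R) (K theta : R) :
  measurable_fun setT psi -> (forall x, `|psi x| <= K) ->
  0 <= theta -> theta * K <= 2^-1 ->
  (\int[mu]_x (expR (theta * psi x))%:E <=
   (expR (theta * \int[mu]_x psi x + 2 * (theta * K) ^+ 2))%:E)%E.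
Proof.
move=> mpsi psiK th0 thK; set m := \int[mu]_x psi x.
have tK x : `|theta * psi x| <= theta * K.
  by rewrite normrM ger0_norm// ler_wpM2l.
have mt : measurable_fun setT (fun x => theta * psi x) by exact: measurable_funM.
have me : measurable_fun setT (fun x => expR (theta * psi x)).
  by apply: measurableT_comp.
have ie : mu.-integrable setT (EFin \o (fun x => expR (theta * psi x))).
  apply: (@bounded_integrable _ _ _ _ _ (expR (theta * K))) => // x.
  by rewrite gtr0_norm ?expR_gt0// ler_expR; exact: le_trans (ler_norm _) (tK x).
have it := bounded_integrable mu mt tK.
have ic : mu.-integrable setT (EFin \o cst (1 + 2 * (theta * K) ^+ 2)).
  exact: finite_measure_integrable_cst.
rewrite EFin_Rintegral// lee_fin.
apply: (@le_trans _ _ (\int[mu]_x (theta * psi x + (1 + 2 * (theta * K) ^+ 2)))).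
  apply: le_Rintegral => //.
    apply: (@bounded_integrable _ _ _ _ _ (theta * K + `|1 + 2 * (theta * K) ^+ 2|)) => [|x].
      exact: measurable_funD.
    by apply: (le_trans (ler_normD _ _)); rewrite lerD2r.
  move=> x _; apply: le_trans (expR_le_quadratic (le_trans (tK x) thK)) _.
  have h : (theta * psi x) ^+ 2 <= (theta * K) ^+ 2.
    by rewrite -real_normK ?num_real// lerXn2r ?nnegrE// (le_trans _ (tK x)).
  by lra.
rewrite RintegralD// Rintegral_prob_cst RintegralZl//; last first.
  exact: bounded_integrable psiK.
rewrite -/m; apply: le_trans (expR_ge1Dx _).
by lra.
Qed.

(** Chernoff's method: the exponential of the sum factors over the coordinates, and [mgf_bound]
    gives each factor up to an error quadratic in [theta]. *)
Lemma wlln_bounded (psi : X -> R) (K c : R) :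
  measurable_fun setT psi -> (forall x, `|psi x| <= K) ->
  \int[mu]_x psi x < c ->
  forall e : R, 0 < e -> exists N, forall n, (N <= n)%N ->
    (power_measure mu n [set x | (n%:R * c <= \sum_(i < n) psi (tnth x i))%R]
       <= e%:E)%E.
Proof.
move=> mpsi psiK mc e e0; set m := \int[mu]_x psi x in mc.
have K0 : 0 <= K.
  by apply: le_trans (bounded_Rintegral mu mpsi psiK); exact: normr_ge0.
pose eta := c - m; have eta0 : 0 < eta by rewrite subr_gt0.
(* The first term puts [theta * psi] in the range of the quadratic bound; the second makes the
   quadratic error at most half of the gain [theta * eta]. *)
pose theta := Num.min (2 * (K + 1))^-1 (eta / (4 * (K + 1) ^+ 2)).
have K1 : 0 < K + 1 by lra.
have K2 : 0 < (K + 1) ^+ 2 by rewrite exprn_gt0.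
have th0 : 0 < theta.
  by rewrite lt_min invr_gt0 mulr_gt0//= divr_gt0// mulr_gt0.
have thK : theta * K <= 2^-1.
  apply: (@le_trans _ _ (theta * (K + 1))); first by rewrite ler_pM2l//; lra.
  by rewrite -ler_pdivlMr// -invfM ge_min mulrC lexx.
have thK2 : 2 * (theta * K) ^+ 2 <= theta * eta / 2.
  have h : theta * (4 * (K + 1) ^+ 2) <= eta.
    by rewrite -ler_pdivlMr ?mulr_gt0// ge_min lexx orbT.
  have h2 : theta * (4 * K ^+ 2) <= eta.
    apply: le_trans h; rewrite ler_pM2l// ler_pM2l// lerXn2r ?nnegrE//; lra.
  have := ler_wpM2l (ltW th0) h2; lra.
have mpos : 0 < theta * eta / 2 by rewrite divr_gt0// mulr_gt0.
(* By [1 + x <= expR x], the bound [expR (- n * theta * eta / 2)] is below [e] once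
   [n * theta * eta / 2] exceeds [e^-1]. *)
exists (Num.truncn (e^-1 / (theta * eta / 2))).+1 => n Nn.
have n1 : e^-1 / (theta * eta / 2) < n%:R.
  apply: lt_le_trans (truncnS_gt _) _.
  by rewrite ler_nat.
pose g x := expR (theta * psi x).
have mg : measurable_fun setT g.
  by apply: measurableT_comp => //; exact: measurable_funM.
have -> : [set x | (n%:R * c <= \sum_(i < n) psi (tnth x i))%R] =
    [set x : n.-tuple X | expR (theta * (n%:R * c)) <= \prod_(i < n) g (tnth x i)].
  apply/seteqP; split => x /=; rewrite -expR_sum ler_expR -mulr_sumr ler_pM2l//.
apply: (le_trans (markov_ineq (measurable_prod_tnth mg) _ (expR_gt0 _)
  (integral_power_prod _ mg _ _ (mgf_bound mpsi psiK (ltW th0) thK)))).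
- by move=> x; apply: prodr_ge0 => i _; exact: expR_ge0.
- by move=> x; exact: expR_ge0.
- exact: expR_ge0.
rewrite lee_fin -expRM_natl -expRB.
apply: (@le_trans _ _ (expR (- (n%:R * (theta * eta / 2))))).
  rewrite ler_expR -/m.
  have := ler_wpM2l (ler0n R n) thK2; rewrite /eta; lra.
rewrite expRN -[leRHS]invrK lef_pV2 ?posrE ?invr_gt0 ?expR_gt0//.
apply: le_trans (expR_ge1Dx _).
by move: n1; rewrite ltr_pdivrMr//; lra.
Qed.

Lemma integrable_excess_small (psi : X -> R) (e : R) :
  mu.-integrable setT (EFin \o psi) -> 0 < e ->
  exists2 K : R, 0 <= K &
    (\int[mu]_x (`|psi x| - Num.min `|psi x| K)%:E <= e%:E)%E.
Proof.
move=> ipsi e0.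
have mpsi : measurable_fun setT psi by exact/measurable_EFinP/(measurable_int _ ipsi).
have mn : measurable_fun setT (fun x => `|psi x|) by exact: measurableT_comp.
pose f_ (k : nat) x := (`|psi x| - Num.min `|psi x| k%:R)%:E.
have mf k : measurable_fun setT (f_ k).
  apply/measurable_EFinP; apply: measurable_funB => //.
  by apply: measurable_minr.
have fpos k x : 0 <= `|psi x| - Num.min `|psi x| k%:R.
  by rewrite subr_ge0 ge_min lexx.
have f_cvg : {ae mu, forall x, setT x -> f_ ^~ x @ \oo --> 0%E}.
  apply: aeW => x _; apply: cvg_near_cst.
  exists (Num.truncn `|psi x|).+1 => // k /= xk; rewrite /f_ min_l ?subrr//.
  by apply/ltW/(lt_le_trans (truncnS_gt _)); rewrite ler_nat.
have f_dom : {ae mu, forall x n, setT x -> (`|f_ n x| <= `|psi x|%:E)%E}.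
  apply: aeW => x k _; rewrite gee0_abs ?lee_fin// gerBl.
  by rewrite le_min normr_ge0 ler0n.
have ig : mu.-integrable setT (fun x => `|psi x|%:E) by exact: (integrable_abse ipsi).
have [_ _ cv] := dominated_convergence measurableT mf (measurable_cst _) f_cvg ig f_dom.
rewrite /= integral0 in cv.
apply: contrapT => hK.
have : (e%:E <= lim ((\int[mu]_x f_ k x)%E @[k --> \oo]))%E.
  apply: lime_ge; first by apply/cvg_ex; exists 0%E.
  apply: nearW => k; rewrite leNgt; apply/negP => /ltW h.
  by apply: hK; exists k%:R.
by rewrite (cvg_lim _ cv)// lee_fin leNgt e0.
Qed.

(* The function is clamped to [-K, K]; the excess is handled by Markov's inequality. *)
Lemma wlln (psi : X -> R) (c : R) :
  mu.-integrable setT (EFin \o psi) -> \int[mu]_x psi x < c ->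
  forall e : R, 0 < e -> exists N, forall n, (N <= n)%N ->
    (power_measure mu n [set x | (n%:R * c <= \sum_(i < n) psi (tnth x i))%R]
       <= e%:E)%E.
Proof.
move=> ipsi mc e e0; set m := \int[mu]_x psi x in mc.
have mpsi : measurable_fun setT psi by exact/measurable_EFinP/(measurable_int _ ipsi).
have mn : measurable_fun setT (fun x => `|psi x|) by exact: measurableT_comp.
(* One third of the gap absorbs the change of mean due to clamping, one is the threshold for the
   excess, one is the margin left to the clamped function. In [tau], the first term serves the mean
   and the second brings Markov's bound [tau / eta] down to [e / 2]. *)
pose eta := (c - m) / 3; have eta0 : 0 < eta by rewrite divr_gt0// subr_gt0.
pose tau := Num.min eta (eta * (e / 2)).
have tau0 : 0 < tau by rewrite lt_min eta0 mulr_gt0// divr_gt0.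
have [K K0 hK] := integrable_excess_small ipsi tau0.
pose r x := `|psi x| - Num.min `|psi x| K.
have r0 x : 0 <= r x by rewrite subr_ge0 ge_min lexx.
have mr : measurable_fun setT r.
  by apply: measurable_funB => //; apply: measurable_minr.
pose psiK x := Num.max (- K) (Num.min (psi x) K).
have mpsiK : measurable_fun setT psiK.
  by apply: measurable_maxr => //; apply: measurable_minr.
have psiKK x : `|psiK x| <= K.
  rewrite ler_norml /psiK le_max lexx/= ge_max ge_min lexx orbT andbT.
  by lra.
have up x : psi x <= psiK x + r x.
  rewrite /psiK /r; have [p0|p0] := leP 0 (psi x).
    by rewrite ger0_norm// max_r; [lra|rewrite le_min; apply/andP; split; lra].
  rewrite ltr0_norm// [Num.min (psi x) K]min_l; last by lra.
  by case: (leP (- K) (psi x)) => ?; case: (leP (- psi x) K) => ?; lra.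
have down x : psiK x <= psi x + r x.
  rewrite /psiK /r; have [p0|p0] := leP 0 (psi x).
    rewrite ger0_norm// max_r; last by rewrite le_min; apply/andP; split; lra.
    by case: (leP (psi x) K) => ?; lra.
  rewrite ltr0_norm// [Num.min (psi x) K]min_l; last by lra.
  by case: (leP (- K) (psi x)) => ?; case: (leP (- psi x) K) => ?; lra.
have ir : mu.-integrable setT (EFin \o r).
  apply/integrableP; split; first exact/measurable_EFinP.
  under eq_integral do rewrite /= ger0_norm//.
  by apply: le_lt_trans hK _; exact: ltry.
have mKlt : \int[mu]_x psiK x < c - eta.
  apply: (@le_lt_trans _ _ (m + tau)); last first.
    have : tau <= eta by rewrite ge_min lexx.
    by rewrite /eta; lra.
  apply: (@le_trans _ _ (\int[mu]_x (psi x + r x))).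
    apply: le_Rintegral => //; first exact: (bounded_integrable mu mpsiK psiKK).
    exact: (integrableD measurableT ipsi ir).
  by rewrite RintegralD// lerD2l -lee_fin -EFin_Rintegral.
have e2 : 0 < e / 2 by rewrite divr_gt0.
have [N hN] := wlln_bounded mpsiK psiKK mKlt e2.
(* The successor keeps [n] positive, as Markov's threshold [n%:R * eta] must be. *)
exists N.+1 => n Nn; have n0 : 0 < n%:R :> R by rewrite ltr0n (leq_trans _ Nn).
have mA g t (mg : measurable_fun setT g) := @measurable_ge_sum R d X n g t mg.
apply: (@le_trans _ _ (power_measure mu n
    ([set x | (n%:R * (c - eta) <= \sum_(i < n) psiK (tnth x i))%R] `|`
     [set x | (n%:R * eta <= \sum_(i < n) r (tnth x i))%R])))%E.
  apply: le_measure; rewrite ?inE; [exact: mA|by apply: measurableU; exact: mA|].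
  move=> x /= h.
  have [?|h1] := leP (n%:R * (c - eta)) (\sum_(i < n) psiK (tnth x i)); [by left|right].
  have : \sum_(i < n) psi (tnth x i) <=
      \sum_(i < n) psiK (tnth x i) + \sum_(i < n) r (tnth x i).
    by rewrite -big_split /=; apply: ler_sum.
  by move: h h1; rewrite mulrBr; lra.
apply: (le_trans (measureU2 _ _ _)); [exact: mA|exact: mA|].
rewrite [e in leRHS](_ : e = e / 2 + e / 2); last by lra.
rewrite EFinD; apply: leeD; first exact/hN/ltnW.
apply: (le_trans (markov_ineq (measurable_sum_tnth mr) _ _ (integral_power_sum _ mr r0 hK))).
- by move=> x; apply: sumr_ge0.
- by rewrite mulr_gt0.
rewrite lee_fin ler_pdivrMr; last exact: mulr_gt0.
have : tau <= eta * (e / 2) by rewrite ge_min lexx orbT.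
by move=> /(ler_wpM2l (ltW n0)); lra.
Qed.

(** Union bound by induction on the list, half of the error going to the head. Measurability is
    carried along because each step removes one set from the previous one. *)
Lemma wlln_family (I : eqType) (s : seq I) (psi : I -> X -> R) (t : I -> R) :
  (forall i, mu.-integrable setT (EFin \o psi i)) ->
  (forall i, \int[mu]_x psi i x < t i) ->
  forall e : R, 0 < e -> exists N, forall n, (N <= n)%N ->
    (measurable [set x : n.-tuple X | forall i, i \in s ->
      \sum_(j < n) psi i (tnth x j) < n%:R * t i]) /\
    (power_measure mu n [set x | forall i, i \in s ->
      (\sum_(j < n) psi i (tnth x j) < n%:R * t i)%R] >= (1 - e)%:E)%E.
Proof.
move=> ipsi it; elim: s => [|k s IH] e e0.
  exists 0%N => n _.
  have -> : [set x : n.-tuple X | forall i, i \in [::] ->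
      \sum_(j < n) psi i (tnth x j) < n%:R * t i] = setT by apply/seteqP; split.
  split=> //; rewrite [X in (_ <= X)%E](probability_setT (power_measure mu n)) lee_fin.
  by lra.
have e2 : 0 < e / 2 by rewrite divr_gt0.
have [N1 h1] := IH _ e2; have [N2 h2] := wlln (ipsi k) (it k) e2.
exists (maxn N1 N2) => n; rewrite geq_max => /andP[/h1[mB PB] /h2 PC].
set B := [set x | _] in mB PB; set C := [set x | _] in PC.
have mpsi : measurable_fun setT (psi k).
  exact/measurable_EFinP/(measurable_int _ (ipsi k)).
have mC : measurable C by exact: measurable_ge_sum.
have -> : [set x : n.-tuple X | forall i, i \in k :: s ->
    \sum_(j < n) psi i (tnth x j) < n%:R * t i] = B `\` C.
  apply/seteqP; split => x.
    move=> h; split; first by move=> i si; apply: h; rewrite in_cons si orbT.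
    by apply/negP; rewrite -ltNge; apply: h; rewrite mem_head.
  move=> [Bx /negP]; rewrite -ltNge => Cx i.
  by rewrite in_cons => /predU1P[->//|]; exact: Bx.
split; first exact: measurableD.
rewrite measureD//; last by rewrite -ge0_fin_numE// fin_num_measure.
rewrite (_ : 1 - e = (1 - e / 2) - e / 2); last by lra.
rewrite EFinB; apply: leeB => //.
by apply: le_trans PC; apply: le_measure; rewrite ?inE//; exact: measurableI.
Qed.

End weak_law.

(** * Optimal pairs of typical samples *)

Section empirical_pair.
Context {R : realType} {d} {X : measurableType d}.
Variables (rho : X -> X -> R) (nu mu : probability X R) (a ro b : R).
Hypothesis a_gt0 : 0 < a.
Hypothesis ro_ge0 : 0 <= ro.
Hypothesis b_ge0 : 0 <= b.
Hypothesis conc : forall n (A : set (n.-tuple X)), (0 < n)%N -> measurable A ->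
  ((2^-1)%:E <= power_measure mu n A)%E -> forall r, ro <= r ->
  ((1 - b * expR (- a * (r - ro) ^+ 2))%:E <=
   outer (power_measure mu n) (enlarge rho A r))%E.
Variable f : X -> R.
Hypothesis f_ge0 : forall x, 0 <= f x.
Hypothesis mf : measurable_fun setT f.
Hypothesis nuE : forall phi : X -> \bar R, (forall x, 0 <= phi x)%E ->
  measurable_fun setT phi -> (\int[nu]_x phi x = \int[mu]_x (phi x * (f x)%:E))%E.
Hypothesis ilnf : nu.-integrable setT (EFin \o (fun x => ln (f x))).

(** Equality holds when all factors are positive. [ln] takes the value 0 at 0, but then the product
    vanishes and the inequality survives. *)
Lemma prod_le_expR_sum_ln n (x : n.-tuple X) :
  \prod_(i < n) f (tnth x i) <= expR (\sum_(i < n) ln (f (tnth x i))).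
Proof.
have [h|] := pselect (forall i, 0 < f (tnth x i)).
  by rewrite expR_sum le_eqVlt; apply/orP; left; apply/eqP/eq_bigr => i _; rewrite lnK ?posrE.
move=> /existsNP[i] /negP; rewrite -leNgt => fi.
rewrite (bigD1 i)//= (_ : f (tnth x i) = 0) ?mul0r ?expR_ge0//.
by apply/eqP; rewrite eq_le fi f_ge0.
Qed.

(** On [B] the likelihood ratio of the two product measures is at most [expR t]. *)
Lemma power_change_of_measure n (B : set (n.-tuple X)) (t : R) : measurable B ->
  (forall x, B x -> \sum_(i < n) ln (f (tnth x i)) <= t) ->
  (power_measure nu n B <= (expR t)%:E * power_measure mu n B)%E.
Proof.
move=> mB Bt.
have mi : measurable_fun setT (fun x => (\1_B x : R)%:E).
  by apply/measurable_EFinP; exact: measurable_indic.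
have i0 (x : n.-tuple X) : (0 <= (\1_B x : R)%:E)%E by rewrite lee_fin.
rewrite -[in leLHS](setIT B) -integral_indic//.
rewrite (power_density f_ge0 mf nuE i0 mi).
rewrite -[in leRHS](setIT B) -(integral_indic _ measurableT)//.
rewrite -ge0_integralZl ?lee_fin ?expR_ge0//.
apply: ge0_le_integral => //.
- by move=> x _; rewrite mule_ge0// lee_fin; apply: prodr_ge0.
- apply: emeasurable_funM => //.
  by apply/measurable_EFinP; exact: measurable_prod_tnth.
- by apply: emeasurable_funM.
move=> x _; rewrite muleC indicE; have [/set_mem xB|_] := boolP (x \in B).
  by rewrite !mule1 lee_fin (le_trans (prod_le_expR_sum_ln x))// ler_expR Bt.
by rewrite !mule0.
Qed.

(** The families [psi] and [phi] say what typical means for each sample. They are left open because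
    the lemma serves twice: with second moments, then with indicators of cells. *)
Lemma empirical_pair (I J : finType) (psi : I -> X -> R) (t : I -> R)
    (phi : J -> X -> R) (u : J -> R) (c : R) :
  0 < c -> \int[nu]_x ln (f x) < a * c ->
  (forall i, nu.-integrable setT (EFin \o psi i)) ->
  (forall i, \int[nu]_x psi i x < t i) ->
  (forall j, mu.-integrable setT (EFin \o phi j)) ->
  (forall j, \int[mu]_x phi j x < u j) ->
  exists n, exists x y : n.-tuple X, [/\ (0 < n)%N,
    sqdist rho x y <= n%:R * c,
    forall i, \sum_(k < n) psi i (tnth x k) < n%:R * t i &
    forall j, \sum_(k < n) phi j (tnth y k) < n%:R * u j].
Proof.
move=> c0 Hac ipsi psit iphi phiu.
set H := \int[nu]_x ln (f x) in Hac.
pose t0 := (H + a * c) / 2.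
have Ht0 : H < t0 by rewrite /t0; lra.
have t0ac : t0 < a * c by rewrite /t0; lra.
(* The index [None] adds the log-likelihood to the statistics required of [nu]-samples, with a level
   [t0] strictly between the entropy and [a * c]. *)
pose psi' (o : option I) := if o is Some i then psi i else fun x => ln (f x).
pose t' (o : option I) := if o is Some i then t i else t0.
have h2 : 0 < 2^-1 :> R by rewrite invr_gt0.
have ipsi' o : nu.-integrable setT (EFin \o psi' o) by case: o.
have psit' o : \int[nu]_x psi' o x < t' o by case: o.
have [N1 hN1] := wlln_family (enum {: option I}) ipsi' psit' h2.
have [N2 hN2] := wlln_family (enum J) iphi phiu h2.
set q := Num.sqrt c; have q0 : 0 < q by rewrite sqrtr_gt0.
have qc : q ^+ 2 = c by rewrite sqr_sqrtr// ltW.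
(* Each summand serves one consequence of [M < k]: the radius [k * q] is at least [ro]; the exponent
   [k * k * t0 - a * (k * q - ro) ^+ 2] is at most [- k]; and [b / (1 + k)] is less than 1/2. *)
pose M := ro / q + (2 * a * ro * q + 1) / (a * c - t0) + 2 * b.
(* The sample size is [k * k], so that [sqrt (k * k * c) = k * q]. *)
pose k := (maxn (Num.truncn M).+1 (maxn N1 N2)).
have g0 : 0 < a * c - t0 by rewrite subr_gt0.
have M1 : 0 <= ro / q by rewrite divr_ge0// ltW.
have M2 : 0 <= (2 * a * ro * q + 1) / (a * c - t0).
  apply: divr_ge0; last exact: ltW.
  apply: addr_ge0 => //; apply: mulr_ge0; last exact: ltW.
  by apply: mulr_ge0 => //; apply: mulr_ge0 => //; exact: ltW.
have b0 := b_ge0; have ro0 := ro_ge0; have a0 := a_gt0.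
have kM : M < k%:R.
  by apply: (lt_le_trans (truncnS_gt M)); rewrite ler_nat leq_maxl.
have k0 : 0 < k%:R :> R by apply: le_lt_trans kM; rewrite /M; lra.
have k_gt0 : (0 < k)%N by rewrite -(ltr_nat R).
have kk : (k <= k * k)%N by rewrite leq_pmulr.
have [mB hB] := hN1 (k * k)%N (leq_trans (leq_trans (leq_trans (leq_maxl _ _)
  (leq_maxr _ _)) (leqnn k)) kk).
have [mA hA] := hN2 (k * k)%N (leq_trans (leq_trans (leq_trans (leq_maxr _ _)
  (leq_maxr _ _)) (leqnn k)) kk).
have half : 1 - 2^-1 = 2^-1 :> R by lra.
rewrite half in hA hB.
set B := [set x | _] in mB hB; set A := [set x | _] in mA hA.
apply: contrapT => nopair.
have n_gt0 : (0 < k * k)%N by rewrite muln_gt0 k_gt0.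
have nkk : (k * k)%:R = k%:R * k%:R :> R by rewrite natrM.
have rkq : ro <= k%:R * q.
  rewrite -ler_pdivrMr//; apply: le_trans (ltW kM); rewrite /M; lra.
(* Without a suitable pair the enlargement of [A] misses [B], so concentration makes [B] tiny under
   the power of [mu]. *)
have AB : enlarge rho A (k%:R * q) `<=` ~` B.
  move=> x [y Ay xy] Bx; apply: nopair; exists (k * k)%N, x, y; split => //.
  - have s0 := sqdist_ge0 rho x y.
    have : rho2n rho x y ^+ 2 <= (k%:R * q) ^+ 2.
      by rewrite lerXn2r ?nnegrE ?sqrtr_ge0// mulr_ge0// ltW.
    by rewrite sqr_sqrtr// exprMn qc nkk -expr2.
  - by move=> i; apply: (Bx (Some i)); rewrite mem_enum.
  - by move=> j; apply: Ay; rewrite mem_enum.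
have := conc n_gt0 mA hA rkq.
set E := a * (k%:R * q - ro) ^+ 2; rewrite mulNr -/E => hout.
have muB : (power_measure mu (k * k) B <= (b * expR (- E))%:E)%E.
  have : ((1 - b * expR (- E))%:E <= power_measure mu (k * k) (~` B))%E.
    apply: (le_trans hout); apply: ereal_inf_lbound.
    by exists (~` B) => //; split => //; exact: measurableC.
  rewrite probability_setC// EFinB.
  have : power_measure mu (k * k) B \is a fin_num by rewrite fin_num_measure.
  by case: (power_measure mu (k * k) B) => [z| |]//= _; rewrite -EFinB !lee_fin; lra.
have nuB := @power_change_of_measure _ B ((k * k)%:R * t0) mB _.
have : 2^-1 <= expR ((k * k)%:R * t0) * (b * expR (- E)).
  rewrite -lee_fin EFinM; apply: (le_trans hB); apply: (le_trans (nuB _)).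
    by move=> x Bx; apply: ltW; apply: (Bx None); rewrite mem_enum.
  by rewrite lee_wpmul2l// lee_fin expR_ge0.
rewrite mulrCA -expRD.
have hE : (k * k)%:R * t0 - E <= - k%:R.
  have k1 : (2 * a * ro * q + 1) <= k%:R * (a * c - t0).
    by rewrite -ler_pdivrMr//; apply: le_trans (ltW kM); rewrite /M; lra.
  have := ler_wpM2l (ltW k0) k1.
  have : 0 <= a * ro ^+ 2 by apply: mulr_ge0; [exact: ltW|exact: sqr_ge0].
  by rewrite nkk /E -qc; lra.
have hk : expR ((k * k)%:R * t0 - E) <= (1 + k%:R)^-1.
  apply: (@le_trans _ _ (expR (- k%:R))); first by rewrite ler_expR.
  by rewrite expRN lef_pV2 ?posrE ?expR_gt0 ?expR_ge1Dx//; lra.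
move=> /le_trans/(_ (ler_wpM2l b0 hk)); rewrite ler_pdivlMr; last by lra.
have : 2 * b < k%:R by apply: le_lt_trans kM; rewrite /M; lra.
by lra.
Qed.

End empirical_pair.

(** * Couplings built from samples *)

Lemma tonelli_prod {R : realType} d1 d2 (T1 : measurableType d1)
    (T2 : measurableType d2) (P1 : probability T1 R) (P2 : probability T2 R)
    (p : T1 -> R) (q : T2 -> R) :
  measurable_fun setT p -> measurable_fun setT q ->
  (forall x, 0 <= p x) -> (forall x, 0 <= q x) ->
  (\int[P1 \x P2]_z (p z.1 * q z.2)%:E =
   \int[P1]_x (p x)%:E * \int[P2]_y (q y)%:E)%E.
Proof.
move=> mp mq p0 q0.
rewrite (fubini_tonelli1 (fun z => (p z.1 * q z.2)%:E)); last 2 first.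
- by apply/measurable_EFinP; apply: measurable_funM; exact: measurableT_comp.
- by move=> z; rewrite lee_fin mulr_ge0.
rewrite -ge0_integralZr//; last 3 first.
- exact/measurable_EFinP.
- by move=> x _; rewrite lee_fin.
- by apply: integral_ge0 => y _; rewrite lee_fin.
apply: eq_integral => x _; rewrite /fubini_F /=.
rewrite -ge0_integralZl//.
- exact/measurable_EFinP.
- by move=> y _; rewrite lee_fin.
- by rewrite lee_fin.
Qed.

Section product_coupling.
Context {R : realType} {d} {X : measurableType d}.
Variables (nu mu : probability X R) (K : finType).
Variables (p q : K -> X -> R) (A B : K -> R).
Hypothesis mp : forall k, measurable_fun setT (p k).
Hypothesis mq : forall k, measurable_fun setT (q k).
Hypothesis p0 : forall k x, 0 <= p k x.
Hypothesis q0 : forall k x, 0 <= q k x.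
Hypothesis pA : forall k, (\int[nu]_x (p k x)%:E = (A k)%:E)%E.
Hypothesis qB : forall k, (\int[mu]_x (q k x)%:E = (B k)%:E)%E.
Hypothesis pB1 : forall x, \sum_k p k x * B k = 1.
Hypothesis Aq1 : forall y, \sum_k A k * q k y = 1.

Let A0 k : 0 <= A k.
Proof. by rewrite -lee_fin -pA; apply: integral_ge0 => x _; rewrite lee_fin. Qed.
Let B0 k : 0 <= B k.
Proof. by rewrite -lee_fin -qB; apply: integral_ge0 => x _; rewrite lee_fin. Qed.

Let h (z : X * X) : R := \sum_k p k z.1 * q k z.2.

Let h0 z : 0 <= h z.
Proof. by apply: sumr_ge0 => k _; exact: mulr_ge0. Qed.

Let mpq k : measurable_fun setT (fun z : X * X => p k z.1 * q k z.2).
Proof. by apply: measurable_funM; exact: measurableT_comp. Qed.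

Let mh : measurable_fun setT h.
Proof. by apply: (measurable_sum _) => k; exact: mpq. Qed.

Let integral_sum_products (p' q' : K -> X -> R) :
  (forall k, measurable_fun setT (p' k)) -> (forall k, measurable_fun setT (q' k)) ->
  (forall k x, 0 <= p' k x) -> (forall k x, 0 <= q' k x) ->
  (\int[nu \x mu]_z (\sum_k p' k z.1 * q' k z.2)%:E =
   \sum_k (\int[nu]_x (p' k x)%:E * \int[mu]_y (q' k y)%:E))%E.
Proof.
move=> mp' mq' p0' q0'.
under eq_integral do rewrite -sumEFin.
rewrite ge0_integral_sum//.
- by apply: eq_bigr => k _; rewrite tonelli_prod.
- by move=> k; apply/measurable_EFinP; apply: measurable_funM; exact: measurableT_comp.
- by move=> k z _; rewrite lee_fin mulr_ge0.
Qed.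

(** Integrating out the second variable turns [q k] into its mass [B k], and [pB1] normalizes the
    result. *)
Let marginal_fst (C : set X) : measurable C ->
  (\int[nu \x mu]_(z in C `*` setT) (h z)%:E = nu C)%E.
Proof.
move=> mC; rewrite integral_mkcond.
transitivity (\int[nu \x mu]_z (\sum_k (\1_C z.1 * p k z.1) * q k z.2)%:E)%E.
  apply: eq_integral => -[x y] _; rewrite patchE /= indicE.
  have [/set_mem [Cx _]|] := boolP ((x, y) \in C `*` setT).
    by rewrite mem_set//; congr _%:E; apply: eq_bigr => k _; rewrite mul1r.
  move=> /negP xy; have -> : (x \in C) = false.
    by apply/negP => /set_mem Cx; apply: xy; rewrite inE.
  by rewrite big1// => k _; rewrite !mul0r.
have mC1 k : measurable_fun setT (fun x => \1_C x * p k x).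
  by apply: measurable_funM => //; exact: measurable_indic.
rewrite (integral_sum_products mC1 mq _ q0); last by move=> k x; rewrite mulr_ge0.
transitivity (\int[nu]_x (\sum_k (\1_C x * p k x * B k)%:E))%E.
  rewrite ge0_integral_sum//.
  - apply: eq_bigr => k _; rewrite qB -ge0_integralZr ?lee_fin//.
    + exact/measurable_EFinP.
    + by move=> x _; rewrite lee_fin mulr_ge0.
  - by move=> k; apply/measurable_EFinP; exact: measurable_funM.
  - by move=> k x _; rewrite lee_fin !mulr_ge0.
under eq_integral do rewrite sumEFin.
rewrite -[C in RHS]setIT -integral_indic//; apply: eq_integral => x _; congr _%:E.
by under eq_bigr do rewrite -mulrA; rewrite -mulr_sumr pB1 mulr1.
Qed.

Let marginal_snd (C : set X) : measurable C ->
  (\int[nu \x mu]_(z in setT `*` C) (h z)%:E = mu C)%E.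
Proof.
move=> mC; rewrite integral_mkcond.
transitivity (\int[nu \x mu]_z (\sum_k p k z.1 * (\1_C z.2 * q k z.2))%:E)%E.
  apply: eq_integral => -[x y] _; rewrite patchE /= indicE.
  have [/set_mem [_ Cy]|] := boolP ((x, y) \in setT `*` C).
    by rewrite mem_set//; congr _%:E; apply: eq_bigr => k _; rewrite mul1r.
  move=> /negP xy; have -> : (y \in C) = false.
    by apply/negP => /set_mem Cy; apply: xy; rewrite inE.
  by rewrite big1// => k _; rewrite mul0r mulr0.
have mC1 k : measurable_fun setT (fun x => \1_C x * q k x).
  by apply: measurable_funM => //; exact: measurable_indic.
rewrite (integral_sum_products mp mC1 p0); last by move=> k x; rewrite mulr_ge0.
transitivity (\int[mu]_x (\sum_k (A k * (\1_C x * q k x))%:E))%E.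
  rewrite ge0_integral_sum//.
  - apply: eq_bigr => k _; rewrite pA -ge0_integralZl ?lee_fin//.
    + exact/measurable_EFinP.
    + by move=> x _; rewrite lee_fin mulr_ge0.
  - by move=> k; apply/measurable_EFinP; exact: measurable_funM.
  - by move=> k x _; rewrite lee_fin !mulr_ge0.
under eq_integral do rewrite sumEFin.
rewrite -[C in RHS]setIT -integral_indic//; apply: eq_integral => x _; congr _%:E.
by under eq_bigr do rewrite mulrCA; rewrite -mulr_sumr Aq1 mulr1.
Qed.

(* The density of the coupling with respect to [nu \x mu] is
   [\sum_k p k x * q k y]. *)
Lemma transport_cost2_le_products (rho : X -> X -> R)
    (al be : K -> X -> R) (S T : K -> R) :
  polish_borel rho ->
  (forall k, measurable_fun setT (al k)) -> (forall k, measurable_fun setT (be k)) ->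
  (forall k x, 0 <= al k x) -> (forall k x, 0 <= be k x) ->
  (forall k x y, 0 < p k x -> 0 < q k y -> rho x y ^+ 2 <= al k x + be k y) ->
  (forall k, \int[nu]_x (al k x * p k x)%:E <= (S k)%:E)%E ->
  (forall k, \int[mu]_y (be k y * q k y)%:E <= (T k)%:E)%E ->
  (transport_cost2 rho nu mu <= (\sum_k (S k * B k + A k * T k))%:E)%E.
Proof.
move=> hrho mal mbe al0 be0 rhole alS beT.
have h1 : (\int[nu \x mu]_z (h z)%:E = 1)%E.
  by have := marginal_fst measurableT; rewrite setXTT => ->; exact: probability_setT.
have [pi [piE piI]] := density_probability h0 mh h1.
have cpi : coupling nu mu pi.
  split=> C mC; rewrite piE.
  - exact: marginal_fst.
  - exact: measurableX.
  - exact: marginal_snd.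
  - exact: measurableX.
apply: (@le_trans _ _ (\int[pi]_z (rho z.1 z.2 ^+ 2)%:E)%E).
  by apply: ereal_inf_lbound; exists pi.
have mr : measurable_fun setT (fun z : X * X => (rho z.1 z.2 ^+ 2)%:E).
  by apply/measurable_EFinP; apply: measurable_funX; exact: (measurable_rho hrho).
rewrite piI//; last by move=> z; rewrite lee_fin sqr_ge0.
have mS k : measurable_fun setT (fun x => al k x * p k x) by exact: measurable_funM.
have mT k : measurable_fun setT (fun x => be k x * q k x) by exact: measurable_funM.
have m1 : measurable_fun setT (fun z : X * X => \sum_k (al k z.1 * p k z.1) * q k z.2).
  apply: (measurable_sum _) => k; apply: measurable_funM.
    exact: (measurableT_comp (mS k)).
  exact: measurableT_comp.
have m2 : measurable_fun setT (fun z : X * X => \sum_k p k z.1 * (be k z.2 * q k z.2)).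
  apply: (measurable_sum _) => k; apply: measurable_funM.
    exact: measurableT_comp.
  exact: (measurableT_comp (mT k)).
have n1 z : 0 <= \sum_k (al k z.1 * p k z.1) * q k z.2.
  by apply: sumr_ge0 => k _; rewrite !mulr_ge0.
have n2 z : 0 <= \sum_k p k z.1 * (be k z.2 * q k z.2).
  by apply: sumr_ge0 => k _; rewrite !mulr_ge0.
apply: (@le_trans _ _ (\int[nu \x mu]_z
    ((\sum_k (al k z.1 * p k z.1) * q k z.2)%:E +
     (\sum_k p k z.1 * (be k z.2 * q k z.2))%:E))%E).
  apply: ge0_le_integral => //.
  - by move=> z _; rewrite mule_ge0// lee_fin ?sqr_ge0.
  - by apply: emeasurable_funM => //; exact/measurable_EFinP.
  - by apply: emeasurable_funD; exact/measurable_EFinP.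
  (* The bound on [rho] is available where both factors are positive; elsewhere the summand
     vanishes. Its form [al + be] makes every term a product of functions of one variable. *)
  move=> z _; rewrite -EFinM -EFinD lee_fin mulr_sumr -big_split /=.
  apply: ler_sum => k _.
  have [pk|] := ltP 0 (p k z.1); last first.
    move=> pk; have -> : p k z.1 = 0 by apply/eqP; rewrite eq_le pk p0.
    by rewrite !(mulr0, mul0r) addr0.
  have [qk|] := ltP 0 (q k z.2); last first.
    move=> qk; have -> : q k z.2 = 0 by apply/eqP; rewrite eq_le qk q0.
    by rewrite !(mulr0, mul0r) addr0.
  have := ler_wpM2r (ltW (mulr_gt0 pk qk)) (rhole k _ _ pk qk); lra.
rewrite ge0_integralD//; last 4 first.
- by move=> z _; rewrite lee_fin.
- exact/measurable_EFinP.
- by move=> z _; rewrite lee_fin.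
- exact/measurable_EFinP.
rewrite (integral_sum_products mS mq _ q0); last by move=> k x; rewrite mulr_ge0.
rewrite (integral_sum_products mp mT p0); last by move=> k x; rewrite mulr_ge0.
rewrite big_split EFinD -!sumEFin; apply: leeD; apply: lee_sum => k _.
  by rewrite qB EFinM lee_wpmul2r// lee_fin.
by rewrite pA EFinM lee_wpmul2l// lee_fin.
Qed.

End product_coupling.

Lemma integral_wsum {R : realType} d (T : measurableType d) (P : probability T R)
    (I : finType) (c G : I -> R) (g : I -> T -> R) :
  (forall i, 0 <= c i) -> (forall i x, 0 <= g i x) ->
  (forall i, measurable_fun setT (g i)) ->
  (forall i, \int[P]_x (g i x)%:E = (G i)%:E)%E ->
  (\int[P]_x (\sum_i c i * g i x)%:E = (\sum_i c i * G i)%:E)%E.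
Proof.
move=> c0 g0 mg gG; under eq_integral do rewrite -sumEFin.
rewrite ge0_integral_sum//.
- rewrite -sumEFin; apply: eq_bigr => i _; rewrite EFinM -gG -ge0_integralZl ?lee_fin//.
    exact/measurable_EFinP.
  by move=> x _; rewrite lee_fin.
- by move=> i; apply/measurable_EFinP; exact: measurable_funM.
- by move=> i x _; rewrite lee_fin mulr_ge0.
Qed.

Lemma integral_complement {R : realType} d (T : measurableType d)
    (P : probability T R) (g : T -> R) (c : R) :
  measurable_fun setT g -> (forall x, 0 <= g x) -> (forall x, g x <= 1) ->
  (\int[P]_x (g x)%:E = c%:E)%E -> (\int[P]_x (1 - g x)%:E = (1 - c)%:E)%E.
Proof.
move=> mg g0 g1 gc.
have gi : P.-integrable setT (EFin \o g).
  by apply: (@bounded_integrable _ _ _ _ _ 1) => // x; rewrite ger0_norm.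
have := integralB measurableT (finite_measure_integrable_cst P 1 measurableT) gi.
rewrite (integral_prob_cst P) [X in (_ - X)%E]gc -EFinB => <-.
by apply: eq_integral => x _.
Qed.

(** * Weights carried by the cells of a finite partition *)

Section cells.
Context {R : realType} {d} {X : measurableType d}.
Variables (J : finType) (cell : X -> J) (good : pred J) (eta : R).
Hypothesis mcell : forall j, measurable (cell @^-1` [set j]).
Hypothesis eta0 : 0 < eta.
Implicit Type P : probability X R.

Definition cell_prob (P : probability X R) j : R := fine (P (cell @^-1` [set j])).

(* Dividing by [cell_prob P j + eta] rather than [cell_prob P j] makes the sums of
   weights over a sample at most its size as soon as no cell is overrepresented by
   more than [eta], and leaves residual marginals of positive mass. *)
Definition weight P j (z : X) : R :=
  if good j then (cell z == j)%:R / (cell_prob P j + eta) else 0.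

Definition weight_mass P j : R :=
  if good j then cell_prob P j / (cell_prob P j + eta) else 0.

Lemma cell_prob_ge0 P j : 0 <= cell_prob P j.
Proof. by apply: fine_ge0; exact: measure_ge0. Qed.

Lemma cell_probE P j : P (cell @^-1` [set j]) = (cell_prob P j)%:E.
Proof. by rewrite fineK// fin_num_measure. Qed.

Lemma cell_prob_le1 P j : cell_prob P j <= 1.
Proof. by rewrite -lee_fin -cell_probE; exact: probability_le1. Qed.

Let den_gt0 P j : 0 < cell_prob P j + eta.
Proof. by apply: ltr_wpDl => //; exact: cell_prob_ge0. Qed.

Lemma weight_ge0 P j z : 0 <= weight P j z.
Proof. by rewrite /weight; case: ifP => // _; rewrite divr_ge0// ltW. Qed.

Let weightE P j z :
  weight P j z = (if good j then (cell_prob P j + eta)^-1 else 0) *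
                 \1_(cell @^-1` [set j]) z.
Proof.
rewrite /weight indicE; case: ifP => _; last by rewrite mul0r.
rewrite mulrC; congr (_ * _%:R).
by congr nat_of_bool; apply/eqP/idP => [h|/set_mem//]; rewrite inE.
Qed.

Lemma measurable_weight P j : measurable_fun setT (weight P j).
Proof.
rewrite (_ : weight P j = fun z => (if good j then (cell_prob P j + eta)^-1 else 0) *
    \1_(cell @^-1` [set j]) z); last by apply/funext => z; exact: weightE.
by apply: measurable_funM => //; exact: measurable_indic.
Qed.

Lemma integral_weight P j :
  (\int[P]_z (weight P j z)%:E = (weight_mass P j)%:E)%E.
Proof.
under eq_integral do rewrite weightE EFinM.
rewrite ge0_integralZl ?lee_fin//; last 2 first.
- by apply/measurable_EFinP; exact: measurable_indic.
- by case: ifP => // _; rewrite invr_ge0 ltW.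
rewrite integral_indic// setIT; have := cell_probE P j => /= ->.
by rewrite -EFinM /weight_mass; case: ifP => _; rewrite ?mul0r// mulrC.
Qed.

Lemma weight_mass_ge0 P j : 0 <= weight_mass P j.
Proof.
by rewrite /weight_mass; case: ifP => // _; rewrite divr_ge0 ?cell_prob_ge0// ltW.
Qed.

(** [x / (x + eta)] is increasing in [x], and a cell probability is at most 1. *)
Lemma weight_mass_le P j : weight_mass P j <= (1 + eta)^-1.
Proof.
have e1 : 0 < 1 + eta by rewrite addr_gt0.
rewrite /weight_mass; case: ifP => _; last by rewrite invr_ge0 ltW.
rewrite ler_pdivrMr// ler_pdivlMl//.
have := cell_prob_le1 P j; have := cell_prob_ge0 P j; have := eta0; nra.
Qed.

Lemma weight_mass_le1 P j : weight_mass P j <= 1.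
Proof.
apply: (le_trans (weight_mass_le P j)); rewrite invf_le1; last by rewrite addr_gt0.
by rewrite lerDl ltW.
Qed.

Section sample.
Variables (P : probability X R) (n : nat) (x : n.-tuple X).
Hypothesis hx : forall j,
  \sum_(k < n) (cell (tnth x k) == j)%:R <= n%:R * (cell_prob P j + eta).

(** Only samples in the cell of [z] contribute, each at most the inverse of [cell_prob + eta], and
    [hx] bounds their number by [n] times that quantity. *)
Lemma sum_weight_le z : \sum_(i < n) weight P (cell (tnth x i)) z <= n%:R.
Proof.
rewrite -(ler_pM2r (den_gt0 P (cell z))); apply: le_trans (hx (cell z)).
rewrite mulr_suml; apply: ler_sum => i _; rewrite /weight (eq_sym (cell z)).
have [e|_] := eqVneq (cell (tnth x i)) (cell z); last by rewrite mul0r if_same mul0r.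
by rewrite e; case: ifP => _; rewrite ?mul0r// mul1r mulVf// gt_eqF.
Qed.

(** Grouped by cells, a good cell [j] contributes at most [n * (P_j + eta) * (eta / (P_j + eta)) = n
    * eta]; a bad one, of weight 0, at most [n * (P_j + eta)]. *)
Lemma sum_defect_le :
  \sum_(i < n) (1 - weight_mass P (cell (tnth x i))) <=
  n%:R * (#|J|%:R * eta + \sum_(j | ~~ good j) cell_prob P j).
Proof.
rewrite (partition_big (fun i => cell (tnth x i)) xpredT)//=.
have -> : #|J|%:R * eta = \sum_(j : J) eta by rewrite sumr_const mulr_natl.
rewrite [X in _ * (_ + X)]big_mkcond -big_split /= mulr_sumr.
apply: ler_sum => j _.
have -> : \sum_(i < n | cell (tnth x i) == j) (1 - weight_mass P (cell (tnth x i))) =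
    (\sum_(i < n) (cell (tnth x i) == j)%:R) * (1 - weight_mass P j).
  rewrite mulr_suml big_mkcond /=; apply: eq_bigr => i _.
  by case: eqP => [->|_]; rewrite ?mul1r ?mul0r.
have w1 : 0 <= 1 - weight_mass P j by rewrite subr_ge0 weight_mass_le1.
apply: (le_trans (ler_wpM2r w1 (hx j))); rewrite -mulrA; apply: ler_wpM2l => //.
rewrite /weight_mass; case: ifP => _ /=; last by rewrite subr0 mulr1 addrC.
by rewrite mulrBr mulr1 [X in _ - X]mulrC divfK ?gt_eqF// addr0 addrC addKr.
Qed.

End sample.
End cells.

(** * The coupling read off from a pair of samples, and its cost *)

Section discretized_coupling.
Context {R : realType} {d} {X : measurableType d}.
Variables (rho : X -> X -> R) (nu mu : probability X R).
Hypothesis hrho : polish_borel rho.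
Variables (J : finType) (cell : X -> J) (good : pred J) (eta delta : R).
Hypothesis mcell : forall j, measurable (cell @^-1` [set j]).
Hypothesis eta0 : 0 < eta.
Hypothesis delta0 : 0 <= delta.
Hypothesis cell_diam : forall x x', cell x = cell x' -> good (cell x) ->
  rho x x' <= delta.
Variables (n : nat) (xs ys : n.-tuple X) (c : R).
Hypothesis n0 : (0 < n)%N.
Hypothesis hxs : forall j, \sum_(k < n) (cell (tnth xs k) == j)%:R <=
  n%:R * (cell_prob cell nu j + eta).
Hypothesis hys : forall j, \sum_(k < n) (cell (tnth ys k) == j)%:R <=
  n%:R * (cell_prob cell mu j + eta).
Hypothesis hc : sqdist rho xs ys <= n%:R * c.
Variables (xo : X) (K tau_nu tau_mu : R).
Hypothesis K0 : 0 <= K.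
Let exc z := rho xo z ^+ 2 - Num.min (rho xo z ^+ 2) K.
Hypothesis excnu : (\int[nu]_z (exc z)%:E <= tau_nu%:E)%E.
Hypothesis excmu : (\int[mu]_z (exc z)%:E <= tau_mu%:E)%E.

Let u i := weight cell good eta nu (cell (tnth xs i)).
Let v i := weight cell good eta mu (cell (tnth ys i)).
Let au i := weight_mass cell good eta nu (cell (tnth xs i)).
Let bv i := weight_mass cell good eta mu (cell (tnth ys i)).

Let nR0 : 0 < n%:R :> R. Proof. by rewrite ltr0n. Qed.

(* [D] and [E] are the densities of the residual marginals, of common mass [m]; the
   coupling is [n^-1 \sum_i u_i * v_i + D * E / m]. *)
Let D z := 1 - \sum_i (n%:R^-1 * bv i) * u i z.
Let E z := 1 - \sum_i (n%:R^-1 * au i) * v i z.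
Let m := 1 - \sum_i (n%:R^-1 * bv i) * au i.

Let au0 i : 0 <= au i. Proof. exact: weight_mass_ge0. Qed.
Let bv0 i : 0 <= bv i. Proof. exact: weight_mass_ge0. Qed.
Let au1 i : au i <= 1. Proof. exact: weight_mass_le1. Qed.
Let bv1 i : bv i <= 1. Proof. exact: weight_mass_le1. Qed.
Let u0 i z : 0 <= u i z. Proof. exact: weight_ge0. Qed.
Let v0 i z : 0 <= v i z. Proof. exact: weight_ge0. Qed.
Let mu_ i : measurable_fun setT (u i). Proof. exact: measurable_weight. Qed.
Let mv_ i : measurable_fun setT (v i). Proof. exact: measurable_weight. Qed.
Let iu i : (\int[nu]_z (u i z)%:E = (au i)%:E)%E. Proof. exact: integral_weight. Qed.
Let iv i : (\int[mu]_z (v i z)%:E = (bv i)%:E)%E. Proof. exact: integral_weight. Qed.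

Let cb0 i : 0 <= n%:R^-1 * bv i. Proof. by rewrite mulr_ge0// invr_ge0 ltW. Qed.
Let ca0 i : 0 <= n%:R^-1 * au i. Proof. by rewrite mulr_ge0// invr_ge0 ltW. Qed.

Let wsum_le1 (w : 'I_n -> X -> R) (e : 'I_n -> R) z :
  (forall i z, 0 <= w i z) -> (forall i, e i <= 1) ->
  \sum_i w i z <= n%:R -> \sum_i (n%:R^-1 * e i) * w i z <= 1.
Proof.
move=> w0 e1 wn; rewrite -(ler_pM2l nR0) mulr1; apply: le_trans wn.
rewrite mulr_sumr; apply: ler_sum => i _.
by rewrite !mulrA mulfV ?gt_eqF// mul1r ler_piMl.
Qed.

Let sumu_le1 z : \sum_i (n%:R^-1 * bv i) * u i z <= 1.
Proof. by apply: wsum_le1 => //; exact: sum_weight_le. Qed.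
Let sumv_le1 z : \sum_i (n%:R^-1 * au i) * v i z <= 1.
Proof. by apply: wsum_le1 => //; exact: sum_weight_le. Qed.
Let sumu_ge0 z : 0 <= \sum_i (n%:R^-1 * bv i) * u i z.
Proof. by apply: sumr_ge0 => i _; rewrite mulr_ge0. Qed.
Let sumv_ge0 z : 0 <= \sum_i (n%:R^-1 * au i) * v i z.
Proof. by apply: sumr_ge0 => i _; rewrite mulr_ge0. Qed.

Let D0 z : 0 <= D z. Proof. by rewrite subr_ge0. Qed.
Let E0 z : 0 <= E z. Proof. by rewrite subr_ge0. Qed.
Let D1 z : D z <= 1. Proof. by rewrite gerBl. Qed.
Let E1 z : E z <= 1. Proof. by rewrite gerBl. Qed.
Let mD : measurable_fun setT D.
Proof.
by apply: measurable_funB => //; apply: (measurable_sum _) => i; exact: measurable_funM.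
Qed.
Let mE : measurable_fun setT E.
Proof.
by apply: measurable_funB => //; apply: (measurable_sum _) => i; exact: measurable_funM.
Qed.

Let iD : (\int[nu]_z (D z)%:E = m%:E)%E.
Proof.
apply: integral_complement => //; last exact: integral_wsum.
by apply: (measurable_sum _) => i; exact: measurable_funM.
Qed.

Let iE : (\int[mu]_z (E z)%:E = m%:E)%E.
Proof.
have -> : m = 1 - \sum_i (n%:R^-1 * au i) * bv i.
  by congr (1 - _); apply: eq_bigr => i _; rewrite mulrAC.
apply: integral_complement => //; last exact: integral_wsum.
by apply: (measurable_sum _) => i; exact: measurable_funM.
Qed.

Let m0 : 0 < m.
Proof.
rewrite subr_gt0; have e1 : 0 < 1 + eta by rewrite addr_gt0.
apply: (@le_lt_trans _ _ (\sum_(i < n) n%:R^-1 * (1 + eta)^-1)).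
  apply: ler_sum => i _; rewrite -mulrA ler_pM2l ?invr_gt0//.
  apply: le_trans (weight_mass_le good mcell eta0 nu (cell (tnth xs i))).
  by rewrite ler_piMl.
rewrite sumr_const card_ord -[_ *+ n]mulr_natl mulVKf ?gt_eqF//.
by rewrite invf_lt1// ltrDl.
Qed.

(** [m] is the average of [1 - bv i * au i], and [1 - s t <= (1 - s) + (1 - t)] on the unit interval
    reduces it to the defects of the two samples. *)
Let m_le : m <= 2 * (#|J|%:R * eta) +
  \sum_(j | ~~ good j) cell_prob cell nu j + \sum_(j | ~~ good j) cell_prob cell mu j.
Proof.
have h1 := sum_defect_le good mcell eta0 hxs.
have h2 := sum_defect_le good mcell eta0 hys.
rewrite -(ler_pM2l nR0).
have -> : n%:R * m = \sum_(i < n) (1 - bv i * au i).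
  rewrite /m mulrBr mulr1 mulr_sumr sumrB sumr_const card_ord; congr (_ - _).
  by apply: eq_bigr => i _; rewrite !mulrA mulfV ?gt_eqF// mul1r.
apply: (@le_trans _ _ (\sum_(i < n) ((1 - au i) + (1 - bv i)))).
  apply: ler_sum => i _; have := au1 i; have := bv1 i; have := au0 i; have := bv0 i.
  by nra.
rewrite big_split /=; apply: (le_trans (lerD h1 h2)).
by rewrite -mulrDr ler_pM2l//; lra.
Qed.

(** Cost of moving between the cells of the two sample points: one cell diameter is added at each
    end. *)
Let C i := (rho (tnth xs i) (tnth ys i) + 2 * delta) ^+ 2.
(** One index per sample pair and one for the residual product. The factors [n%:R^-1] and [m^-1] are
    placed on the [p] side only. *)
Let K' : finType := ('I_n + 'I_1)%type.
Let p (k : K') z := match k with inl i => n%:R^-1 * u i z | inr _ => m^-1 * D z end.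
Let q (k : K') z := match k with inl i => v i z | inr _ => E z end.
Let A (k : K') := match k with inl i => n%:R^-1 * au i | inr _ => 1 end.
Let B (k : K') := match k with inl i => bv i | inr _ => m end.
(** On the residual part the cost passes through the base point [xo], by
    [(s + t)^2 <= 2 s^2 + 2 t^2]. *)
Let al (k : K') z := match k with inl i => C i | inr _ => 2 * rho xo z ^+ 2 end.
Let be (k : K') z := match k with inl i => 0 | inr _ => 2 * rho xo z ^+ 2 end.
Let S (k : K') :=
  match k with inl i => C i * (n%:R^-1 * au i) | inr _ => m^-1 * (2 * (K * m + tau_nu)) end.
Let T (k : K') := match k with inl i => 0 | inr _ => 2 * (K * m + tau_mu) end.

Let weight_pos P j z : 0 < weight cell good eta P j z -> good j /\ cell z = j.
Proof.
rewrite /weight; case: ifP => // _; last by rewrite ltxx.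
by case: eqP => // _; rewrite mul0r ltxx.
Qed.

Let mrho2 : measurable_fun setT (fun z => rho xo z ^+ 2).
Proof.
rewrite (_ : (fun z => rho xo z ^+ 2) = (fun z => rho z xo ^+ 2)).
  by apply: measurable_funX; exact: (measurable_rhol hrho).
by apply/funext => z; rewrite (rhoC hrho).
Qed.

Let exc0 z : 0 <= exc z. Proof. by rewrite subr_ge0 ge_min lexx. Qed.
Let mexc : measurable_fun setT exc.
Proof. by apply: measurable_funB => //; apply: measurable_minr. Qed.

(** Split [rho xo z ^+ 2 <= K + exc z]: the constant meets the small mass [m] of [F], while the
    excess needs only [F <= 1]. *)
Let residual_cost (P : probability X R) (F : X -> R) tau :
  measurable_fun setT F -> (forall z, 0 <= F z) -> (forall z, F z <= 1) ->
  (\int[P]_z (F z)%:E = m%:E)%E -> (\int[P]_z (exc z)%:E <= tau%:E)%E ->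
  (\int[P]_z (2 * rho xo z ^+ 2 * F z)%:E <= (2 * (K * m + tau))%:E)%E.
Proof.
move=> mF F0 F1 iF hexc.
apply: (@le_trans _ _ (\int[P]_z ((2 * K)%:E * (F z)%:E + 2%:E * (exc z)%:E))%E).
  apply: ge0_le_integral => //.
  - move=> z _; rewrite lee_fin; apply: mulr_ge0 => //; apply: mulr_ge0 => //.
    exact: sqr_ge0.
  - by apply/measurable_EFinP; do 2 apply: measurable_funM => //.
  - by apply: emeasurable_funD; apply: emeasurable_funM => //; exact/measurable_EFinP.
  move=> z _; rewrite -!EFinM -EFinD lee_fin.
  have : rho xo z ^+ 2 <= K + exc z by rewrite /exc addrCA lerDl subr_ge0 ge_min lexx orbT.
  have := F0 z; have := F1 z; have := exc0 z => h1 h2 h3 h4.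
  have := ler_wpM2r h3 h4; have := ler_wpM2l h1 h2; lra.
rewrite ge0_integralD//; last 4 first.
- by move=> z _; rewrite mule_ge0// lee_fin ?mulr_ge0.
- by apply: emeasurable_funM => //; exact/measurable_EFinP.
- by move=> z _; rewrite mule_ge0// lee_fin.
- by apply: emeasurable_funM => //; exact/measurable_EFinP.
rewrite !ge0_integralZl ?lee_fin//; last 5 first.
- exact/measurable_EFinP.
- by move=> z _; rewrite lee_fin.
- exact/measurable_EFinP.
- by move=> z _; rewrite lee_fin.
- by rewrite mulr_ge0.
rewrite iF -EFinM (_ : 2 * (K * m + tau) = 2 * K * m + 2 * tau); last by ring.
rewrite [leRHS]EFinD; apply: leeD => //.
by rewrite EFinM lee_wpmul2l// lee_fin.
Qed.

Lemma transport_cost2_le_empirical :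
  (transport_cost2 rho nu mu <=
   ((1 + delta) * c + 4 * delta ^+ 2 + 4 * delta +
    4 * K * (2 * (#|J|%:R * eta) + \sum_(j | ~~ good j) cell_prob cell nu j +
      \sum_(j | ~~ good j) cell_prob cell mu j) + 2 * tau_nu + 2 * tau_mu)%:E)%E.
Proof.
apply: (le_trans (@transport_cost2_le_products _ _ _ nu mu K' p q A B
  _ _ _ _ _ _ _ _ rho al be S T hrho _ _ _ _ _ _ _)).
- by case=> i; rewrite /p /=; apply: measurable_funM.
- by case.
- case=> i z; rewrite /p /=; first by rewrite mulr_ge0// invr_ge0 ltW.
  by rewrite mulr_ge0// invr_ge0 ltW.
- by case.
- case=> i; rewrite /p /S /al /A /=.
    under eq_integral do rewrite EFinM.
    rewrite ge0_integralZl ?lee_fin ?invr_ge0 ?ler0n//; first by rewrite iu.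
    - exact/measurable_EFinP.
    - by move=> z _; rewrite lee_fin.
  under eq_integral do rewrite EFinM.
  rewrite ge0_integralZl ?lee_fin ?invr_ge0 ?ltW//.
  - by rewrite iD -EFinM mulVf// gt_eqF.
  - exact/measurable_EFinP.
  - by move=> z _; rewrite lee_fin.
- by case.
- move=> z; rewrite big_sumType /= big_ord1 mulrAC mulVf ?gt_eqF// mul1r /D addrCA.
  by rewrite -[X in _ + (X - _)](eq_bigr _ (fun i _ => mulrAC _ _ _)) subrr addr0.
- by move=> z; rewrite big_sumType /= big_ord1 mul1r /E addrCA subrr addr0.
- by case=> i //; rewrite /al /=; apply: measurable_funM.
- by case=> i; rewrite /be /=; [exact: measurable_cst|apply: measurable_funM].
- by case=> i z; [exact: sqr_ge0|rewrite mulr_ge0// sqr_ge0].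
- by case=> i z //; rewrite mulr_ge0// sqr_ge0.
- case=> i x y /=; last first.
    move=> _ _; have := rho_triangle hrho x xo y; rewrite (rhoC hrho x xo).
    have := rho_ge0 hrho xo x; have := rho_ge0 hrho xo y; have := rho_ge0 hrho x y.
    set r1 := rho x y; set r2 := rho xo x; set r3 := rho xo y => h1 h2 h3 h4.
    apply: (@le_trans _ _ ((r2 + r3) ^+ 2)).
      by rewrite lerXn2r ?nnegrE// addr_ge0.
    by have := sqr_ge0 (r2 - r3); lra.
  (* Positive weights place [x] in the cell of the sample point of [xs] and [y] in that of [ys],
     both good. *)
  rewrite pmulr_rgt0 ?invr_gt0// => /weight_pos[g1 e1] /weight_pos[g2 e2].
  rewrite addr0 lerXn2r ?nnegrE ?(rho_ge0 hrho)//.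
    by rewrite addr_ge0 ?(rho_ge0 hrho)// mulr_ge0.
  have h1 := cell_diam e1; have h2 := cell_diam e2.
  rewrite e1 in h1; rewrite e2 in h2; have {}h1 := h1 g1; have {}h2 := h2 g2.
  have := rho_triangle hrho x (tnth xs i) y.
  have := rho_triangle hrho (tnth xs i) (tnth ys i) y.
  rewrite (rhoC hrho (tnth ys i) y); lra.
- case=> i; rewrite /p /S /al /A /=.
    under eq_integral do rewrite EFinM.
    rewrite ge0_integralZl ?lee_fin ?sqr_ge0//; last 2 first.
    - by apply/measurable_EFinP; apply: measurable_funM.
    - by move=> z _; rewrite lee_fin mulr_ge0// invr_ge0.
    under eq_integral do rewrite EFinM.
    rewrite ge0_integralZl ?lee_fin ?invr_ge0 ?ler0n//; first by rewrite iu.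
    - exact/measurable_EFinP.
    - by move=> z _; rewrite lee_fin.
  have mi0 : 0 <= m^-1 by rewrite invr_ge0 ltW.
  under eq_integral do rewrite mulrCA EFinM.
  rewrite ge0_integralZl ?lee_fin//.
  - by rewrite [leRHS]EFinM lee_wpmul2l ?lee_fin//; exact: residual_cost.
  - by apply/measurable_EFinP; do 2 apply: measurable_funM => //.
  - move=> z _; rewrite lee_fin; apply: mulr_ge0 => //; apply: mulr_ge0 => //.
    exact: sqr_ge0.
- case=> i /=; last exact: residual_cost.
  by under eq_integral do rewrite mul0r; rewrite integral0.
rewrite lee_fin big_sumType /= big_ord1.
have hC : \sum_(i < n) (C i * (n%:R^-1 * au i) * bv i + n%:R^-1 * au i * 0) <=
    (1 + delta) * c + 4 * delta ^+ 2 + 4 * delta.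
  apply: (@le_trans _ _ (\sum_(i < n) n%:R^-1 *
      ((1 + delta) * rho (tnth xs i) (tnth ys i) ^+ 2 + (4 * delta ^+ 2 + 4 * delta)))).
    apply: ler_sum => i _; rewrite mulr0 addr0.
    rewrite (_ : C i * (n%:R^-1 * au i) * bv i = n%:R^-1 * (C i * (au i * bv i))); last first.
      by move: (C i) => C'; ring.
    rewrite ler_pM2l ?invr_gt0//.
    have C0 : 0 <= C i by exact: sqr_ge0.
    have ab : au i * bv i <= 1 by apply: mulr_ile1.
    have ab0 : 0 <= au i * bv i by rewrite mulr_ge0.
    apply: (@le_trans _ _ (C i)); first by rewrite ler_piMr.
    rewrite /C; set r := rho _ _.
    (* [delta * (r - 2) ^+ 2 >= 0] bounds the cross term [4 * delta * r] by
       [delta * r ^+ 2 + 4 * delta]. *)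
    have := ler_wpM2l delta0 (sqr_ge0 (r - 2)); lra.
  rewrite -mulr_sumr ler_pdivrMl// big_split /= sumr_const card_ord -mulr_sumr.
  rewrite -[_ *+ n]mulr_natl -addrA !mulrDr -!mulrDr.
  rewrite [leRHS]mulrDr lerD2r mulrCA ler_wpM2l// ?addr_ge0//.
have mm : m != 0 by rewrite gt_eqF.
have -> : m^-1 * (2 * (K * m + tau_nu)) * m + 1 * (2 * (K * m + tau_mu)) =
   4 * K * m + 2 * tau_nu + 2 * tau_mu by field.
have := ler_wpM2l (mulr_ge0 (ler0n R 4) K0) m_le; lra.
Qed.

End discretized_coupling.

(** * Relative entropy *)

Section entropy.
Context {R : realType} {d} {X : measurableType d}.
Variables (nu mu : probability X R).

Definition real_density (f : X -> R) :=
  [/\ forall x, 0 <= f x, measurable_fun setT f &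
    forall phi : X -> \bar R, (forall x, 0 <= phi x)%E -> measurable_fun setT phi ->
      (\int[nu]_x phi x = \int[mu]_x (phi x * (f x)%:E))%E].

(** The chosen version of the derivative is nonnegative and finite at every point, so [fine] loses
    nothing. *)
Lemma real_density_exists : nu `<< mu -> exists f, real_density f /\
  (rel_entropy nu mu = \int[nu]_x (ln (f x))%:E)%E.
Proof.
move=> num.
set F := Radon_Nikodym_SigmaFinite.f nu mu.
have F0 := Radon_Nikodym_SigmaFinite.f_ge0 num : forall x, (0 <= F x)%E.
have Ffin := Radon_Nikodym_SigmaFinite.f_fin_num num : forall x, F x \is a fin_num.
have Fint := Radon_Nikodym_SigmaFinite.f_integrable num : mu.-integrable setT F.
have fE x : (fine (F x))%:E = F x by rewrite fineK.
have Feq : EFin \o (fine \o F) = F by apply/funext => x /=.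
have mf : measurable_fun setT (fine \o F).
  by apply/measurable_EFinP; rewrite Feq; exact: (measurable_int _ Fint).
exists (fine \o F); split; first split.
- by move=> x; exact: fine_ge0.
- exact: mf.
- move=> phi phi0 mphi; rewrite -(Radon_Nikodym_SigmaFinite.change_of_variables num)//.
  by apply: eq_integral => x _; rewrite fE.
apply: rel_entropy_density => //.
- by move=> x; exact: fine_ge0.
- by rewrite Feq.
- move=> A mA; rewrite [LHS](Radon_Nikodym_SigmaFinite.f_integral num mA).
  by apply: eq_integral => x _; rewrite fE.
- exact: measurableT_comp.
Qed.

Variable f : X -> R.
Hypothesis hf : real_density f.

Let f0 : forall x, 0 <= f x. Proof. by case: hf. Qed.
Let mf : measurable_fun setT f. Proof. by case: hf. Qed.
Let hnu := let: And3 _ _ h := hf in h.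

Let mfV : measurable_fun setT (fun x => (f x)^-1).
Proof.
(* With the convention [0^-1 = 0], the inverse is written through measurable maps off the zero
   set. *)
have -> : (fun x => (f x)^-1) = (fun x => if f x == 0 then 0 else expR (- ln (f x))).
  apply/funext => x; case: eqP => [->|/eqP fx]; first by rewrite invr0.
  by rewrite expRN lnK// posrE lt_neqAle eq_sym fx f0.
apply: measurable_fun_ifT => //.
  by apply: measurable_fun_eqr.
by apply: measurableT_comp => //; apply: measurableT_comp => //; exact: measurableT_comp.
Qed.

Let mlnf : measurable_fun setT (fun x => ln (f x)).
Proof. exact: measurableT_comp. Qed.

(** Against [nu], the inverse density integrates to the [mu]-mass of the set where [f] is
    positive. *)
Let integral_fV : (\int[nu]_x ((f x)^-1)%:E <= 1)%E.
Proof.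
rewrite hnu; last 2 first.
- by move=> x; rewrite lee_fin invr_ge0.
- exact/measurable_EFinP.
rewrite -(integral_prob_cst mu 1); apply: ge0_le_integral => //.
- by move=> x _; rewrite mule_ge0 ?lee_fin ?invr_ge0.
- by apply: emeasurable_funM; exact/measurable_EFinP.
move=> x _; rewrite -EFinM lee_fin.
by have [->|fx] := eqVneq (f x) 0; rewrite ?mulr0// mulVf.
Qed.

Let ifV : nu.-integrable setT (EFin \o (fun x => (f x)^-1)).
Proof.
apply/integrableP; split; first exact/measurable_EFinP.
under eq_integral do rewrite /= ger0_norm ?invr_ge0//.
by apply: le_lt_trans integral_fV _; exact: ltry.
Qed.

(** [ln y <= y] at [y = (f x)^-1]; where [f] vanishes both sides are 0 by convention. *)
Let ln_ge x : - (f x)^-1 <= ln (f x).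
Proof.
have [->|fx] := eqVneq (f x) 0; first by rewrite invr0 oppr0 ln0.
have fx0 : 0 < f x by rewrite lt_neqAle eq_sym fx f0.
by rewrite lerNl -lnV ?posrE//; apply/ltW/ln_sublinear; rewrite invr_gt0.
Qed.

(** The negative part of [ln f] is dominated by the [nu]-integrable inverse of [f], so only the
    positive part can diverge. *)
Lemma rel_entropy_integrable :
  (\int[nu]_x (ln (f x))%:E = +oo)%E \/
  nu.-integrable setT (EFin \o (fun x => ln (f x))).
Proof.
have mL : measurable_fun setT (EFin \o (fun x => ln (f x))) by exact/measurable_EFinP.
have neg : (\int[nu]_x ((fun x => (ln (f x))%:E)^\- x) < +oo)%E.
  apply: (@le_lt_trans _ _ (\int[nu]_x ((f x)^-1)%:E)%E); last first.
    by apply: le_lt_trans integral_fV _; exact: ltry.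
  apply: ge0_le_integral => //.
  - exact: measurable_funeneg.
  - exact/measurable_EFinP.
  move=> x _; rewrite funenegE ge_max -EFinN !lee_fin invr_ge0 f0 andbT.
  by rewrite lerNl; exact: ln_ge.
have [pos|pos] := eqVneq (\int[nu]_x ((fun x => (ln (f x))%:E)^\+ x))%E +oo%E.
  by left; rewrite integralE pos addye// eqe_oppLR /= lt_eqF.
right; apply/integrableP; split => //.
under eq_integral do rewrite -/((abse \o (EFin \o (fun x => ln (f x)))) _) fune_abse.
rewrite ge0_integralD//.
- by apply: lte_add_pinfty => //; rewrite ltey.
- exact: measurable_funepos.
- exact: measurable_funeneg.
Qed.

(** Integrate [1 <= ln (f x) + (f x)^-1] over the set where [f] is positive, which has full
    [nu]-measure, and use [integral_fV]. *)
Lemma entropy_ge0 : nu.-integrable setT (EFin \o (fun x => ln (f x))) ->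
  0 <= \int[nu]_x ln (f x).
Proof.
move=> iln; pose S := [set x | 0 < f x].
have mS : measurable S.
  rewrite -[X in measurable X]setTI.
  by apply: (@measurable_fun_ltr _ _ _ setT (cst 0) f).
have mi : measurable_fun setT (\1_S : X -> R) by exact: measurable_indic.
have iS : nu.-integrable setT (EFin \o (\1_S : X -> R)) by exact: integrable_indic.
have S1 : \int[nu]_x \1_S x = 1 :> R.
  apply: EFin_inj; rewrite -EFin_Rintegral// hnu; last 2 first.
  - by move=> x; rewrite lee_fin.
  - exact/measurable_EFinP.
  transitivity (\int[mu]_x (1%:E * (f x)%:E))%E.
    apply: eq_integral => x _; rewrite mul1e -EFinM indicE.
    have [|] := boolP (x \in S); first by rewrite mul1r.
    rewrite notin_setE /S /= => /negP; rewrite -leNgt => fx.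
    by rewrite mul0r; congr _%:E; apply/eqP; rewrite eq_le f0.
  by rewrite -(hnu (fun=> lee01) (measurable_cst _)) integral_prob_cst.
have : \int[nu]_x \1_S x <= \int[nu]_x (ln (f x) + (f x)^-1).
  apply: le_Rintegral => //; first exact: (integrableD measurableT iln ifV).
  move=> x _; rewrite indicE.
  have [/set_mem fx|_] := boolP (x \in S).
    have := expR_ge1Dx (- ln (f x)); rewrite expRN lnK ?posrE//= => h.
    by rewrite /=; lra.
  by have := ln_ge x; rewrite mulr0n; lra.
rewrite S1 RintegralD//.
have : \int[nu]_x (f x)^-1 <= 1 by rewrite -lee_fin -EFin_Rintegral.
lra.
Qed.

End entropy.

(** * The transport inequality from concentration *)

Section ball_cells.
Context {R : realType} {d} {X : measurableType d}.
Variable rho : X -> X -> R.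
Hypothesis hrho : polish_borel rho.
Variables (D : nat -> X) (r : R).
Hypothesis hD : forall x, exists k, rho x (D k) < r.

(* The value [ord_max] means that [x] is in none of the first [k] balls. *)
Definition ball_index k (x : X) : 'I_k.+1 :=
  inord (find (fun j => rho x (D j) < r) (iota 0 k)).

Let find_le k x : (find (fun j => (rho x (D j) < r)%R) (iota 0 k) < k.+1)%N.
Proof. by rewrite ltnS -[leqRHS](size_iota 0 k); exact: find_size. Qed.

Let measurable_find (s : seq nat) m :
  measurable [set x | find (fun j => rho x (D j) < r) s = m].
Proof.
elim: s m => [|a s IH] m /=.
  have [->|m0] := eqVneq m 0%N.
    by rewrite (_ : [set _ | _] = setT)//; apply/seteqP; split.
  rewrite (_ : [set _ | _] = set0)//; apply/seteqP; split => // x /= /esym/eqP.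
  by rewrite (negbTE m0).
case: m => [|m].
  rewrite (_ : [set _ | _] = [set x | rho x (D a) < r]).
    exact: (measurable_rho_ball hrho).
  by apply/seteqP; split => x /=; case: ifP.
rewrite (_ : [set _ | _] = ~` [set x | rho x (D a) < r] `&`
    [set x | find (fun j => rho x (D j) < r) s = m]).
  by apply: measurableI => //; apply: measurableC; exact: (measurable_rho_ball hrho).
apply/seteqP; split => x /=; case: ifP => // h.
  by move=> [->].
by move=> [].
by move=> [_ ->].
Qed.

Lemma measurable_ball_index k j : measurable (ball_index k @^-1` [set j]).
Proof.
rewrite (_ : _ @^-1` _ = [set x | find (fun j => rho x (D j) < r) (iota 0 k) = j]).
  exact: measurable_find.
apply/seteqP; split => x /=.
  by move=> <-; rewrite /ball_index inordK.
by move=> h; apply/val_inj => /=; rewrite /ball_index inordK.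
Qed.

Lemma ball_index_lt k x : (ball_index k x < k)%N -> rho x (D (ball_index k x)) < r.
Proof.
rewrite /ball_index inordK// => h.
have : has (fun j => rho x (D j) < r) (iota 0 k) by rewrite has_find size_iota.
by move=> /(nth_find 0%N); rewrite nth_iota ?add0n.
Qed.

Lemma ball_index_diam k x x' : ball_index k x = ball_index k x' ->
  ball_index k x != ord_max -> rho x x' <= 2 * r.
Proof.
move=> e xk; have lk : (ball_index k x < k)%N.
  by rewrite ltn_neqAle -ltnS ltn_ord andbT; apply: contraNneq xk => h; apply/eqP/val_inj.
have h1 := ball_index_lt lk; have := ball_index_lt (x := x') (k := k).
rewrite -e => /(_ lk) h2.
have := rho_triangle hrho x (D (ball_index k x)) x'.
rewrite (rhoC hrho (D _) x'); lra.
Qed.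

(** The points outside the first [k] balls form sets decreasing to the empty set, and [P] is
    continuous from above. *)
Lemma ball_index_max_small (P : probability X R) e : 0 < e ->
  exists N, forall k, (N <= k)%N -> cell_prob (ball_index k) P ord_max <= e.
Proof.
move=> e0; pose B k := [set x | forall j, (j < k)%N -> r <= rho x (D j)].
have BE k : ball_index k @^-1` [set ord_max] = B k.
  apply/seteqP; split => x /=.
    move=> /(congr1 val) /=; rewrite /ball_index inordK// => h j jk.
    rewrite leNgt; apply/negP => xj.
    have : has (fun j => rho x (D j) < r) (iota 0 k).
      by apply/hasP; exists j => //; rewrite mem_iota.
    by rewrite has_find size_iota h ltnn.
  move=> Bx; apply/val_inj; rewrite /ball_index /= inordK//.
  rewrite hasNfind ?size_iota//; apply/hasPn => j.
  by rewrite mem_iota add0n /= => jk; rewrite -leNgt; exact: Bx.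
have mB k : measurable (B k) by rewrite -BE; exact: measurable_ball_index.
have B0 : \bigcap_k B k = set0.
  apply/seteqP; split => // x Bx; have [k xk] := hD x.
  by have := Bx k.+1 I k (ltnSn k); rewrite leNgt xk.
have niB : nonincreasing_seq B.
  by move=> i j ij; apply/subsetPset => x Bx k ki; apply: Bx; exact: leq_trans ki ij.
have : P (B k) @[k --> \oo] --> P (\bigcap_k B k).
  apply: nonincreasing_cvg_mu => //.
  - by rewrite -ge0_fin_numE// fin_num_measure.
  - by rewrite B0.
rewrite B0 measure0 => cv.
have [N PN] : exists N, (P (B N) <= e%:E)%E.
  apply: contrapT => hN.
  have : (e%:E <= lim (P (B k) @[k --> \oo]))%E.
    apply: lime_ge; first by apply/cvg_ex; exists 0%E.
    by apply: nearW => k; rewrite leNgt; apply/negP => /ltW h; apply: hN; exists k.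
  by rewrite (cvg_lim _ cv)// lee_fin leNgt e0.
exists N => k Nk; rewrite -lee_fin -cell_probE; last exact: measurable_ball_index.
rewrite BE; apply: le_trans PN; apply: le_measure; rewrite ?inE//.
exact/subsetPset/niB.
Qed.

End ball_cells.

(** * Second moment and transport cost of a measure of finite entropy *)

Section transport_from_concentration.
Context {R : realType} {d} {X : measurableType d}.
Variables (rho : X -> X -> R) (nu mu : probability X R) (a ro b : R).
Hypothesis hrho : polish_borel rho.
Hypothesis a_gt0 : 0 < a.
Hypothesis ro_ge0 : 0 <= ro.
Hypothesis b_ge0 : 0 <= b.
Hypothesis conc : forall n (A : set (n.-tuple X)), (0 < n)%N -> measurable A ->
  ((2^-1)%:E <= power_measure mu n A)%E -> forall r, ro <= r ->
  ((1 - b * expR (- a * (r - ro) ^+ 2))%:E <=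
   outer (power_measure mu n) (enlarge rho A r))%E.
Variable xo : X.
Hypothesis mu2 : (\int[mu]_x ((rho xo x) ^+ 2)%:E < +oo)%E.
Variable f : X -> R.
Hypothesis hf : real_density nu mu f.
Hypothesis ilnf : nu.-integrable setT (EFin \o (fun x => ln (f x))).

Let rho2 x := rho xo x ^+ 2.

Let mrho2 : measurable_fun setT rho2.
Proof.
rewrite (_ : rho2 = (fun z => rho z xo ^+ 2)).
  by apply: measurable_funX; exact: (measurable_rhol hrho).
by apply/funext => z; rewrite /rho2 (rhoC hrho).
Qed.

Let rho2_ge0 x : 0 <= rho2 x. Proof. exact: sqr_ge0. Qed.

Let integrable_rho2 (P : probability X R) :
  (\int[P]_x (rho2 x)%:E < +oo)%E -> P.-integrable setT (EFin \o rho2).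
Proof.
move=> h; apply/integrableP; split; first exact/measurable_EFinP.
by under eq_integral do rewrite /= ger0_norm//.
Qed.

Let irho2mu : mu.-integrable setT (EFin \o rho2) := integrable_rho2 mu2.

(** A [nu]-sample lies close to a [mu]-sample of controlled second moment. This bounds the truncated
    moments of [nu] uniformly in the truncation, and monotone convergence concludes. *)
Lemma density_second_moment : (\int[nu]_x (rho2 x)%:E < +oo)%E.
Proof.
have [f0 mf hnu] := hf.
pose c := (\int[nu]_x ln (f x)) / a + 1.
pose c' := Num.max c 1.
have c0 : 0 < c' by rewrite lt_max ltr01 orbT.
have Hc : \int[nu]_x ln (f x) < a * c'.
  rewrite mulrC -ltr_pdivrMr//; apply: (@lt_le_trans _ _ c); first by rewrite ltrDl.
  by rewrite le_max lexx.
(* Average of [2 * rho2 (y_k) + 2 * rho (x_k, y_k) ^+ 2] over the sample, with a tolerance 1 for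
   each of the two typical means. *)
pose Q := 2 * c' + 2 * (\int[mu]_x rho2 x + 1) + 1.
have bound (M : nat) : (\int[nu]_x (Num.min (rho2 x) M%:R)%:E <= Q%:E)%E.
  pose g x := Num.min (rho2 x) M%:R.
  have mg : measurable_fun setT g by apply: measurable_minr.
  have gM x : `|g x| <= M%:R.
    by rewrite ger0_norm /g ?ge_min ?lexx ?orbT// le_min rho2_ge0 ler0n.
  have ig := bounded_integrable nu mg gM.
  have ingg : nu.-integrable setT (EFin \o (fun x => - g x)).
    apply: (@bounded_integrable _ _ _ _ _ M%:R) => [|x]; last by rewrite normrN.
    exact: measurableT_comp.
  (* [empirical_pair] bounds sums from above only; a lower bound on the sum of [g] is obtained from
     [- g]. *)
  have [n [xs [ys [n0 hc hx hy]]]] := empirical_pair a_gt0 ro_ge0 b_ge0 conc f0 mf hnu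
    ilnf (I := unit) (J := unit) (psi := fun=> fun x => - g x)
    (t := fun=> \int[nu]_x - g x + 1) (phi := fun=> rho2)
    (u := fun=> \int[mu]_x rho2 x + 1) c0 Hc (fun=> ingg)
    (fun=> ltr_pwDr ltr01 (lexx _)) (fun=> irho2mu) (fun=> ltr_pwDr ltr01 (lexx _)).
  have nR : 0 < n%:R :> R by rewrite ltr0n.
  have intN : \int[nu]_x - g x = - \int[nu]_x g x.
    by under eq_Rintegral do rewrite -mulN1r; rewrite RintegralZl// mulN1r.
  have {}hx := hx tt; have {}hy := hy tt; rewrite intN in hx.
  rewrite EFin_Rintegral// lee_fin -(ler_pM2l nR).
  have h : \sum_(k < n) g (tnth xs k) <= 2 * \sum_(k < n) rho2 (tnth ys k) +
      2 * sqdist rho xs ys.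
    rewrite /sqdist !mulr_sumr -big_split /=; apply: ler_sum => k _.
    apply: (@le_trans _ _ (rho2 (tnth xs k))); first by rewrite ge_min lexx.
    have := rho_triangle hrho xo (tnth ys k) (tnth xs k); rewrite /rho2.
    rewrite (rhoC hrho (tnth ys k)); have := rho_ge0 hrho xo (tnth xs k).
    have := rho_ge0 hrho xo (tnth ys k); have := rho_ge0 hrho (tnth xs k) (tnth ys k).
    set p := rho xo (tnth xs k); set q := rho xo (tnth ys k); set s := rho _ _.
    move=> s0 q0 p0 pqs; apply: (@le_trans _ _ ((q + s) ^+ 2)).
      by rewrite lerXn2r ?nnegrE// addr_ge0.
    by have := sqr_ge0 (q - s); lra.
  rewrite sumrN in hx.
  move: hx hy hc h; rewrite /Q; lra.
apply: (@le_lt_trans _ _ Q%:E); last exact: ltry.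
have -> : (\int[nu]_x (rho2 x)%:E =
    \int[nu]_x (lim ((Num.min (rho2 x) k%:R)%:E @[k --> \oo])))%E.
  apply: eq_integral => x _; apply/esym/cvg_lim => //.
  apply: cvg_near_cst; exists (Num.truncn (rho2 x)).+1 => // k /= xk.
  by rewrite min_l//; apply/ltW/(lt_le_trans (truncnS_gt _)); rewrite ler_nat.
rewrite monotone_convergence//.
- apply: lime_le; last by apply: nearW => k; exact: bound.
  apply: ereal_nondecreasing_is_cvgn => i j ij; apply: ge0_le_integral => //.
  - by move=> x _; rewrite lee_fin le_min rho2_ge0 ler0n.
  - by apply/measurable_EFinP; apply: measurable_minr.
  - by apply/measurable_EFinP; apply: measurable_minr.
  - by move=> x _; rewrite lee_fin le_min !ge_min lexx /= ler_nat ij orbT.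
- by move=> k; apply/measurable_EFinP; apply: measurable_minr.
- by move=> k x _; rewrite lee_fin le_min rho2_ge0 ler0n.
- by move=> x _ i j ij; rewrite lee_fin le_min !ge_min lexx /= ler_nat ij orbT.
Qed.

Let irho2nu : nu.-integrable setT (EFin \o rho2) := integrable_rho2 density_second_moment.

Let excess_small (e : R) : 0 < e -> exists2 K, 0 <= K &
  (\int[nu]_x (rho2 x - Num.min (rho2 x) K)%:E <= e%:E)%E /\
  (\int[mu]_x (rho2 x - Num.min (rho2 x) K)%:E <= e%:E)%E.
Proof.
move=> e0.
have excess (P : probability X R) : P.-integrable setT (EFin \o rho2) -> exists2 K, 0 <= K &
    forall K', K <= K' -> (\int[P]_x (rho2 x - Num.min (rho2 x) K')%:E <= e%:E)%E.
  move=> iP; have [K K0 h] := integrable_excess_small iP e0; exists K => // K' KK'.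
  apply: le_trans h; apply: ge0_le_integral => //.
  - by move=> x _; rewrite lee_fin subr_ge0 ge_min lexx.
  - by apply/measurable_EFinP; apply: measurable_funB => //; apply: measurable_minr.
  - apply/measurable_EFinP; apply: measurable_funB; first exact: measurableT_comp.
    by apply: measurable_minr => //; exact: measurableT_comp.
  move=> x _; rewrite lee_fin ger0_norm// lerB// le_min !ge_min lexx /=.
  by rewrite KK' orbT.
have [K1 K10 h1] := excess _ irho2nu; have [K2 K20 h2] := excess _ irho2mu.
exists (Num.max K1 K2); first by rewrite le_max K10.
by split; [apply: h1|apply: h2]; rewrite le_max lexx ?orbT.
Qed.

Lemma transport_cost2_le_of_entropy_lt (c e : R) :
  0 < c -> \int[nu]_x ln (f x) < a * c -> 0 < e ->
  (transport_cost2 rho nu mu <= (c + e)%:E)%E.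
Proof.
move=> c0 Hc e0; have [f0 mf hnu] := hf.
(* Since [delta <= 1], the diameter terms are at most [delta * (c + 8)], hence [e / 4]. The tails,
   bounded by [e / 16] each, account for another [e / 4]. *)
pose delta := Num.min 1 (e / (4 * (c + 8))).
have delta0 : 0 < delta by rewrite lt_min ltr01 divr_gt0// mulr_gt0// addr_gt0.
have hdelta : delta * c + 4 * delta ^+ 2 + 4 * delta <= e / 4.
  have h1 : delta <= 1 by rewrite ge_min lexx.
  have h2 : delta * (4 * (c + 8)) <= e.
    by rewrite -ler_pdivlMr ?mulr_gt0 ?addr_gt0// ge_min lexx orbT.
  have := ler_wpM2l (ltW delta0) h1; lra.
have e16 : 0 < e / 16 by rewrite divr_gt0.
have [K K0 [hK1 hK2]] := excess_small e16.
(* The residual mass is at most [4 * theta]: [2 * theta] from the frequencies and [theta] from the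
   uncovered region under each measure. Times [4 * K], this is at most [e / 4]. *)
pose theta := e / (64 * (K + 1)).
have K1 : 0 < K + 1 by rewrite ltr_wpDl.
have theta0 : 0 < theta by rewrite divr_gt0// mulr_gt0.
have htheta : theta * (64 * (K + 1)) = e by rewrite /theta mulfVK// gt_eqF// mulr_gt0.
have [D hD0] : rho_separable rho by case: hrho.
have d2 : 0 < delta / 2 by rewrite divr_gt0.
have hD x : exists k, rho x (D k) < delta / 2 by exact: hD0.
have [N1 hN1] := ball_index_max_small hrho hD nu theta0.
have [N2 hN2] := ball_index_max_small hrho hD mu theta0.
pose k := maxn N1 N2; pose cell := ball_index rho D (delta / 2) k.
have mcell j : measurable (cell @^-1` [set j]) := measurable_ball_index hrho D (delta / 2) j.
(* The tolerance is shared among the [k.+1] cells, so that it sums to [theta]. *)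
pose eta := theta / k.+1%:R.
have eta0 : 0 < eta by rewrite divr_gt0.
pose psi (j : 'I_k.+1) x : R := (cell x == j)%:R.
have psiE j : psi j = \1_(cell @^-1` [set j]).
  apply/funext => x; rewrite /psi indicE; congr (nat_of_bool _)%:R.
  by apply/eqP/idP => [h|/set_mem//]; rewrite inE.
have ipsi (P : probability X R) j : P.-integrable setT (EFin \o psi j).
  by rewrite psiE; exact: integrable_indic.
have psilt (P : probability X R) j : \int[P]_x psi j x < cell_prob cell P j + eta.
  rewrite -lte_fin -EFin_Rintegral// psiE integral_indic// setIT.
  by rewrite [ltLHS](cell_probE mcell) lte_fin ltrDl.
have [n [xs [ys [n0 hc hx hy]]]] := empirical_pair a_gt0 ro_ge0 b_ge0 conc f0 mf hnu
  ilnf c0 Hc (ipsi nu) (psilt nu) (ipsi mu) (psilt mu).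
have cell_diam x x' : cell x = cell x' -> cell x != ord_max -> rho x x' <= delta.
  by move=> h1 h2; rewrite -[delta](divfK (x := 2))// mulrC; exact: ball_index_diam h1 h2.
have := transport_cost2_le_empirical (good := fun j => j != ord_max)
  hrho mcell eta0 (ltW delta0) cell_diam n0
  (fun j => ltW (hx j)) (fun j => ltW (hy j)) hc K0 hK1 hK2.
move=> /le_trans; apply; rewrite lee_fin.
rewrite card_ord (_ : k.+1%:R * eta = theta); last by rewrite mulrC divfK.
have sum_bad (P : probability X R) :
    \sum_(j < k.+1 | ~~ (j != ord_max)) cell_prob cell P j = cell_prob cell P ord_max.
  by rewrite (big_pred1 ord_max)// => j; rewrite negbK.
rewrite !sum_bad.
have := hN1 k (leq_maxl _ _); have := hN2 k (leq_maxr _ _); rewrite -/cell => b2 b1.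
have h4 : 0 <= 4 * K by rewrite mulr_ge0.
have := ler_wpM2l h4 b1; have := ler_wpM2l h4 b2.
by lra.
Qed.

End transport_from_concentration.

(** * Equivalence of dimension-free concentration and the transport inequality *)

Theorem theorem3p1 (R : realType) (d : measure_display) (X : measurableType d)
    (rho : X -> X -> R) (mu : probability X R) (a : R) :
  polish_borel rho -> finite_second_moment rho mu -> 0 < a ->
  (exists ro b : R, [/\ 0 <= ro, 0 <= b &
     forall (n : nat) (P : {measure set (n.-tuple X) -> \bar R}),
       (0 < n)%N -> is_prod_measure mu P ->
       forall A : set (n.-tuple X), measurable A -> (P A >= (2^-1)%:E)%E ->
       forall r : R, ro <= r ->
         (outer P (enlarge rho A r) >= (1 - b * expR (- a * (r - ro) ^+ 2))%:E)%E])
  <->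
  (forall nu : probability X R,
     (transport_cost2 rho nu mu <= (a^-1)%:E * rel_entropy nu mu)%E).
Proof.
move=> hrho [xo mu2] a0; split.
  move=> [ro [b [ro0 b0 h]]] nu.
  have [num|num] := pselect (nu `<< mu); last first.
    by rewrite /rel_entropy; case: pselect => // _; rewrite gt0_muley ?leey// lte_fin invr_gt0.
  have [f [hf ->]] := real_density_exists num.
  have [->|iln] := rel_entropy_integrable hf.
    by rewrite gt0_muley ?leey// lte_fin invr_gt0.
  have conc n (A : set (n.-tuple X)) (n0 : (0 < n)%N) (mA : measurable A) :=
    h n (power_measure mu n) n0 (@power_measure_prod _ _ _ mu n) A mA.
  rewrite EFin_Rintegral// -EFinM; set H := \int[nu]_x ln (f x).
  have H0 : 0 <= H := entropy_ge0 hf iln.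
  apply/lee_addgt0Pr => e e0; rewrite -EFinD.
  have e2 : 0 < e / 2 by rewrite divr_gt0.
  (* The level [a^-1 * H + e / 2] is positive because [H >= 0], and strictly above [a^-1 * H]; the
     other [e / 2] is the loss allowed in the construction of the coupling. *)
  have -> : a^-1 * H + e = (a^-1 * H + e / 2) + e / 2 by lra.
  apply: (transport_cost2_le_of_entropy_lt hrho a0 ro0 b0 conc mu2 hf iln) => //.
    by rewrite ltr_wpDl// mulr_ge0// invr_ge0 ltW.
  by rewrite mulrDr mulVKf ?gt_eqF// ltrDl mulr_gt0.
move=> T2; exists (Num.sqrt (ln 2 / a)), 1; split => //.
move=> n P n0 hP A mA PA r rr.
have PE := prod_measure_unique hP.
have -> : outer P (enlarge rho A r) = outer (power_measure mu n) (enlarge rho A r).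
  rewrite /outer; congr ereal_inf; apply/seteqP.
  by split=> _ [B [mB AB] <-]; exists B; rewrite // PE.
by apply: concentration => //; rewrite -PE.
Qed.
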